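(* Let $f:\mathbb{R}^d\to\mathbb{R}$ be continuously differentiable with $L$-Lipschitz continuous gradient, and let $f^*=\min_{x\in\mathbb{R}^d}f(x)$. Let $\delta_S^{(2)}>0$, $\epsilon_S\in(0,1)$, $\delta_1>0$, $l\in\mathbb{N}^+$ be such that $$\delta_S<\frac{c}{(c+1)^2},\qquad \left[(1-\delta_S)(1-\delta_1)-1+\frac{c}{(c+1)^2}\right]^{-1}>0,$$ where $\delta_S=e^{-l\epsilon_S^2/4}+\delta_S^{(2)}$. Apply the random-subspace trust region algorithm described in the context to $f$, where $\|B_k\|_2\le B_{\max}$ for all $k$ and some constant $B_{\max}\ge0$, and where $\mathcal S$ is the distribution of $l\times d$ scaled Gaussian matrices, i.e. matrices with independent $N(0,l^{-1})$ entries. Let $\epsilon>0$ and suppose the algorithm runs for $N$ iterations with $$N\ \ge\ \left[(1-\delta_S)(1-\delta_1)-1+\frac{c}{(c+1)^2}\right]^{-1}\left[\frac{f(x_0)-f^*}{h(\epsilon,\alpha_0\gamma_1^{c+\tau_\alpha})}+\frac{\tau_\alpha}{1+c}\right],$$ where $$h(\epsilon,\alpha_0\gamma_1^{c+\tau_\alpha})=\theta C_7(1-\epsilon_S)\epsilon^2\gamma_1^{c+1}\min\left\{\frac{C_7(1-\theta)}{(L+\frac12B_{\max})S_{\max}^2},\ \frac1{B_{\max}},\ \frac{\alpha_0}{(1-\epsilon_S)^{1/2}\epsilon\gamma_2}\right\},$$ $S_{\max}=1+\sqrt{\frac dl}+\sqrt{\frac2l\log(1/\delta_S^{(2)})}$,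 and $\tau_\alpha=\left\lceil\log_{\gamma_1}\left(\min\{\alpha_{low}/\alpha_0,\,1/\gamma_2\}\right)\right\rceil$ with $\alpha_{low}=(1-\epsilon_S)^{1/2}\epsilon\min\left(\frac{C_7(1-\theta)}{(L+\frac12B_{\max})S_{\max}^2},\frac1{B_{\max}}\right)$. Then $$\mathbb{P}(N\ge N_\epsilon)\ \ge\ 1-e^{-\frac{\delta_1^2}{2}(1-\delta_S)N},$$ where $N_\epsilon=\inf\{M:\min_{k\le M}\|\nabla f(x_k)\|_2\le\epsilon\}$.
   Context: Random-subspace trust region algorithm. Choose a distribution $\mathcal S$ of random matrices in $\mathbb{R}^{l\times d}$ with $l\le d$, and constants $\gamma_1\in(0,1)$, $\gamma_2=\gamma_1^{-c}$ for some $c\in\mathbb{N}^+$ (positive integers), $\theta\in(0,1)$, $\alpha_{\max}>0$, a starting point $x_0\in\mathbb{R}^d$, and $\alpha_0=\alpha_{\max}\gamma_1^p$ for some $p\in\mathbb{N}^+$. For $k=0,1,\dots$: (1) Draw $S_k\in\mathbb{R}^{l\times d}$ from $\mathcal S$ (independently of all previous iterations) and let $\hat m_k(\hat s)=f(x_k)+\langle S_k\nabla f(x_k),\hat s\rangle+\frac12\langle\hat s,S_kB_kS_k^T\hat s\rangle$, where $B_k\in\mathbb{R}^{d\times d}$ is a user-chosen positive semi-definite matrix ($B_k=0$ is allowed). Compute $\hat s_k\in\mathbb{R}^l$ by approximately minimising $\hat m_k$ such that, for some constant $C_7>0$ (independent of $k$), $\|\hat s_k\|_2\le\alpha_k$ and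 $\hat m_k(0)-\hat m_k(\hat s_k)\ge C_7\|S_k\nabla f(x_k)\|_2\min\left\{\alpha_k,\frac{\|S_k\nabla f(x_k)\|_2}{\|B_k\|_2}\right\}$. Set $s_k=S_k^T\hat s_k$. (2) Check the sufficient decrease condition $f(x_k)-f(x_k+s_k)\ge\theta[\hat m_k(0)-\hat m_k(\hat s_k)]$. (3) If it holds, set $x_{k+1}=x_k+s_k$, $\alpha_{k+1}=\min\{\alpha_{\max},\gamma_2\alpha_k\}$ (successful); otherwise $x_{k+1}=x_k$, $\alpha_{k+1}=\gamma_1\alpha_k$ (unsuccessful). Convention: quotients with denominator $\|B_k\|_2=0$ or $B_{\max}=0$ are read as $+\infty$ inside the minima. *)

(* Defs.v *)
From HB Require Import structures.
From mathcomp Require Import all_boot all_order all_algebra.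
From mathcomp Require Import all_classical all_reals all_analysis.

Set Implicit Arguments.
Unset Strict Implicit.
Unset Printing Implicit Defensive.

Import Order.TTheory GRing.Theory Num.Theory.
Import numFieldNormedType.Exports.

Local Open Scope classical_set_scope.
Local Open Scope ring_scope.

(* The library norm `|v| on matrices is the max norm; the Euclidean norm and
   the spectral norm it induces are therefore defined here. *)
Definition dot (R : realType) n (u v : 'cV[R]_n) : R :=
  \sum_(i < n) u i 0 * v i 0.

Definition norm2 (R : realType) n (v : 'cV[R]_n) : R := Num.sqrt (dot v v).

Definition opnorm2 (R : realType) n (B : 'M[R]_n) : R :=
  sup [set norm2 (B *m v) | v in [set v : 'cV[R]_n | norm2 v <= 1]].

(* Symmetry is not required, so that both usages of the term are covered. *)
Definition possemidef (R : realType) n (B : 'M[R]_n) : Prop :=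
  forall v : 'cV[R]_n, 0 <= dot v (B *m v).

Definition grad (R : realType) n (f : 'cV[R]_n -> R) (x : 'cV[R]_n) : 'cV[R]_n :=
  \col_(i < n) 'D_(delta_mx i 0) f x.

Definition continuously_differentiable (R : realType) n (f : 'cV[R]_n -> R) : Prop :=
  (forall x, differentiable f x) /\ continuous (grad f).

Definition lipschitz_gradient (R : realType) n (f : 'cV[R]_n -> R) (L : R) : Prop :=
  0 <= L /\ forall x y, norm2 (grad f x - grad f y) <= L * norm2 (x - y).

Definition is_minimum (R : realType) n (f : 'cV[R]_n -> R) (m : R) : Prop :=
  (exists x, f x = m) /\ forall x, m <= f x.

(* a / b, read as +oo as soon as b = 0 (including the case a = 0, where the
   library division on \bar R would give 0). *)
Definition quot_oo (R : realType) (a b : R) : \bar R :=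
  if b == 0 then +oo%E else (a / b)%:E.

Section Algorithm.
Variables (R : realType) (l d : nat).
Implicit Types (f : 'cV[R]_d -> R) (x : 'cV[R]_d) (S : 'M[R]_(l, d))
  (B : 'M[R]_d) (s : 'cV[R]_l).

Definition model f x S B s : R :=
  f x + dot (S *m grad f x) s + 2^-1 * dot s (S *m B *m S^T *m s).

Definition model_decrease f x S B s : R := model f x S B 0 - model f x S B s.

Definition sufficient_decrease f (theta : R) x S B s : bool :=
  theta * model_decrease f x S B s <= f x - f (x + S^T *m s).

(* One run (one sample path) of the method: x_ k, alpha k, S k, B k and s k are
   the iterate, the radius, the sketch, the Hessian approximation and the
   reduced step of iteration k. *)
Record trust_region_run f (gamma1 gamma2 theta alphamax C7 : R)
    (x0 : 'cV[R]_d) (alpha0 : R)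
    (S : nat -> 'M[R]_(l, d)) (B : nat -> 'M[R]_d) (s : nat -> 'cV[R]_l)
    (x_ : nat -> 'cV[R]_d) (alpha : nat -> R) : Prop := TrustRegionRun {
  run_x0 : x_ 0%N = x0;
  run_alpha0 : alpha 0%N = alpha0;
  run_possemidef : forall k, possemidef (B k);
  run_radius : forall k, norm2 (s k) <= alpha k;
  run_model_decrease : forall k,
    ((C7 * norm2 (S k *m grad f (x_ k)))%:E *
       mine (alpha k)%:E
            (quot_oo (norm2 (S k *m grad f (x_ k))) (opnorm2 (B k)))
     <= (model_decrease f (x_ k) (S k) (B k) (s k))%:E)%E;
  run_x : forall k, x_ k.+1 =
    if sufficient_decrease f theta (x_ k) (S k) (B k) (s k)
    then x_ k + (S k)^T *m s k else x_ k;
  run_alpha : forall k, alpha k.+1 =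
    if sufficient_decrease f theta (x_ k) (S k) (B k) (s k)
    then Num.min alphamax (gamma2 * alpha k) else gamma1 * alpha k
}.

End Algorithm.

(* The infimum of the set of all M such that min_(k <= M) g k <= eps, which is
   +oo when there is no such M. *)
Definition N_eps (R : realType) (g : nat -> R) (eps : R) : \bar R :=
  ereal_inf [set M%:R%:E | M in
    [set M : nat | \big[Num.min/g 0%N]_(k < M.+1) g k <= eps]].

Section Probability.
Context {dO : measure_display} {Omega : measurableType dO} {R : realType}.
Variable P : probability Omega R.

Definition independent_rvs (I : finType) (X : I -> Omega -> R) : Prop :=
  forall A : I -> set R, (forall i, measurable (A i)) ->
  P (\bigcap_i (X i @^-1` A i)) = (\prod_i P (X i @^-1` A i))%E.

Definition independent_systems (G H : set (set Omega)) : Prop :=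
  forall E F, G E -> H F -> P (E `&` F) = (P E * P F)%E.

Definition measurable_mx m n (M : Omega -> 'M[R]_(m, n)) : Prop :=
  forall i j, measurable_fun setT (fun w => M w i j).

(* Generators of the sigma-algebra of a random matrix. *)
Definition mx_events m n (M : Omega -> 'M[R]_(m, n)) : set (set Omega) :=
  \bigcup_(ij : 'I_m * 'I_n)
    preimage_set_system setT (fun w => M w ij.1 ij.2) measurable.

(* normal_prob takes the standard deviation, so the variance is l^-1. *)
Definition scaled_gaussian_mx l d (S : Omega -> 'M[R]_(l, d)) : Prop :=
  [/\ measurable_mx S,
      forall i j (A : set R), measurable A ->
        P [set w | A (S w i j)] = normal_prob 0 (Num.sqrt l%:R^-1) A &
      independent_rvs (fun (ij : 'I_l * 'I_d) w => S w ij.1 ij.2)].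

(* The sigma-algebra of the iterations before iteration k.  The iterates and
   the radii up to time k are functions of these matrices and of the
   deterministic starting values. *)
Definition history l d (S : nat -> Omega -> 'M[R]_(l, d))
    (B : nat -> Omega -> 'M[R]_d) (s : nat -> Omega -> 'cV[R]_l) (k : nat) :
    set (set Omega) :=
  <<s \bigcup_(j in [set j | (j < k)%N])
        (mx_events (S j) `|` mx_events (B j) `|` mx_events (s j)) >>.

(* The algorithm with scaled Gaussian sketches.  The choices B k and s k may be
   random and may depend on the past, on S k and on extra randomness. *)
Record gaussian_trust_region l d (f : 'cV[R]_d -> R)
    (gamma1 gamma2 theta alphamax C7 : R) (x0 : 'cV[R]_d) (alpha0 : R)
    (S : nat -> Omega -> 'M[R]_(l, d)) (B : nat -> Omega -> 'M[R]_d)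
    (s : nat -> Omega -> 'cV[R]_l) (x_ : nat -> Omega -> 'cV[R]_d)
    (alpha : nat -> Omega -> R) : Prop := GaussianTrustRegion {
  gtr_gaussian : forall k, scaled_gaussian_mx (S k);
  gtr_measurable_B : forall k, measurable_mx (B k);
  gtr_measurable_s : forall k, measurable_mx (s k);
  gtr_independent : forall k,
    independent_systems (history S B s k) <<s mx_events (S k) >>;
  gtr_run : forall w,
    trust_region_run f gamma1 gamma2 theta alphamax C7 x0 alpha0
      (S ^~ w) (B ^~ w) (s ^~ w) (x_ ^~ w) (alpha ^~ w)
}.

End Probability.

(* Main.v *)
(* On one sample path write alpha_k = alphamax * gamma1 ^ n_k. Call iteration k
   true when |S_k g_k|^2 >= (1 - epsS) |g_k|^2 and |S_k^T s|^2 <= 2 Smax^2 |s|^2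
   for all s. True iterations with a small radius are successful, true
   successful iterations with a large radius decrease f by at least h, and two
   potentials in n_k bound the number of all other true iterations. As B_k is
   positive semi-definite its curvature term has the favourable sign in the
   sufficient decrease test, which is what makes the factor 2 in front of
   Smax^2 affordable.

   An iteration fails to be true with conditional probability at most deltaS.
   For the lower tail of |S g|^2 the Gaussian entries are integrated out one at
   a time, a Gaussian of a square staying of that form. For the operator norm,
   the factor 2 allows a PAC-Bayes argument in place of Gaussian comparison and
   concentration: exp (lam v^T S z - lam^2 |v|^2 |z|^2 / (2 l)) has mean 1 for
   every v and z, hence so has its average over sums v, z of fair coin flips,
   and by Gibbs' inequality this average dominates the exponential of
   lam u^T S w minus the cost of biasing the coins to have means u and w.
   A Chernoff bound for adapted events concludes. *)

Require Import Defs.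
From HB Require Import structures.
From mathcomp Require Import all_boot all_order all_algebra.
From mathcomp Require Import all_classical all_reals all_analysis.
From mathcomp Require Import measurable_realfun zify ring lra.

Set Implicit Arguments.
Unset Strict Implicit.
Unset Printing Implicit Defensive.

Import Order.TTheory GRing.Theory Num.Theory.
Import numFieldNormedType.Exports.

Local Open Scope classical_set_scope.
Local Open Scope ring_scope.

(** * Independence *)

Section Freezing.
Context {dO : measure_display} {Omega : measurableType dO} {R : realType}.
Variable P : probability Omega R.

(** No conditional expectation is formed. The bound for iteration [k] reads: every event [A] of the
    past meets the failure of [E k] with probability at most [deltaS] times [P A]. To prove it, the
    identity of [Omega] is viewed as two random variables, one into [Omega] with the sigma-algebra
    of the past, one into [Omega] with that of [S k]. Independence makes their joint law a product,
    so the gradient direction, a function of the past, can be frozen while the sketch is integrated.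
    Normalising the gradient, with an arbitrary unit vector in place of 0, keeps this bound valid at
    every iterate. The operator norm needs all directions at once. The average over fair coins does
    not involve [u] and [w], so one Markov inequality at level [delta2^-1] covers them all; the
    biased coins occur only in a deterministic inequality between finite sums. The potentials allow
    at most [c / (c+1) * N + tau / (c+1)] true iterations besides those that decrease [f] by [h]. As
    [c / (c+1) = 1 - c / (c+1)^2 - 1 / (c+1)^2], the assumed size of [N] exceeds what the count
    requires by a margin of [N / (c+1)^2]. *)

Lemma integral_independent d1 d2 (T1 : measurableType d1)
    (T2 : measurableType d2) (X : Omega -> T1) (Y : Omega -> T2)
    (mX : measurable_fun setT X) (mY : measurable_fun setT Y)
    (indep : forall A B, measurable A -> measurable B ->
       P (X @^-1` A `&` Y @^-1` B) = (P (X @^-1` A) * P (Y @^-1` B))%E)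
    (F : T1 * T2 -> \bar R) :
  measurable_fun setT F -> (forall z, 0 <= F z)%E ->
  (\int[P]_w F (X w, Y w) = \int[P]_w \int[P]_w' F (X w', Y w))%E.
Proof.
move=> mF F0.
have mXY : measurable_fun setT (fun w => (X w, Y w)).
  exact/measurable_fun_pair.
pose X' : {mfun Omega >-> T1} := HB.pack X (isMeasurableFun.Build _ _ _ _ _ mX).
pose Y' : {mfun Omega >-> T2} := HB.pack Y (isMeasurableFun.Build _ _ _ _ _ mY).
pose XY : {mfun Omega >-> (T1 * T2)%type} :=
  HB.pack (fun w => (X w, Y w)) (isMeasurableFun.Build _ _ _ _ _ mXY).
transitivity (\int[distribution P XY]_z F z)%E.
  by rewrite ge0_integral_distribution.
transitivity (\int[distribution P X' \x distribution P Y']_z F z)%E.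
  apply: eq_measure_integral => A mA _; apply/esym.
  by apply: product_measure_unique => // B C mB mC; exact: indep.
rewrite fubini_tonelli2// ge0_integral_distribution//; last 2 first.
- exact: measurable_fun_fubini_tonelli_G.
- by move=> y; apply: integral_ge0.
apply: eq_integral => w _ /=; rewrite /fubini_G ge0_integral_distribution//.
exact: measurableT_comp.
Qed.

Lemma measurable_partial_integral d1 d2 (T1 : measurableType d1)
    (T2 : measurableType d2) (X : Omega -> T1) (Y : Omega -> T2)
    (mX : measurable_fun setT X) (mY : measurable_fun setT Y)
    (F : T1 * T2 -> \bar R) :
  measurable_fun setT F -> (forall z, 0 <= F z)%E ->
  measurable_fun setT (fun w => \int[P]_w' F (X w', Y w))%E.
Proof.
move=> mF F0.
pose X' : {mfun Omega >-> T1} := HB.pack X (isMeasurableFun.Build _ _ _ _ _ mX).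
rewrite (_ : (fun _ => _) = fubini_G (distribution P X') F \o Y).
  exact: (measurableT_comp (measurable_fun_fubini_tonelli_G _ mF F0) mY).
apply/funext => w; rewrite /fubini_G /= ge0_integral_distribution//.
exact: measurableT_comp.
Qed.

Variables (I : finType) (X : I -> Omega -> R).
Hypothesis mX : forall i, measurable_fun setT (X i).

Definition other_events (i0 : I) : set (set Omega) :=
  \bigcup_(i in [set i | i != i0]) preimage_set_system setT (X i) measurable.

Lemma other_events_measurable i0 : other_events i0 `<=` measurable.
Proof. by move=> _ [i _ [B mB <-]]; exact: mX. Qed.

Lemma measurable_other i0 i : i != i0 ->
  measurable_fun [set: g_sigma_algebraType (other_events i0)] (X i).
Proof.
move=> ii0 _ B mB; apply: sub_sigma_algebra.
by exists i => //; exists B.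
Qed.

Lemma independent_other (i0 : I) : independent_rvs P X ->
  forall A B, measurable A -> <<s other_events i0 >> B ->
    P (X i0 @^-1` A `&` B) = (P (X i0 @^-1` A) * P B)%E.
Proof.
move=> indep A B mA.
(* Rectangles that are trivial at [i0] form a pi-system generating the sigma-algebra of the other
   variables, so it suffices to compare two finite measures on them. *)
pose G : set (set Omega) := [set C | exists D : I -> set R,
  [/\ forall i, measurable (D i), D i0 = setT & C = \bigcap_i (X i @^-1` D i)]].
have mXA i D : measurable D -> measurable (X i @^-1` D).
  by move=> mD; rewrite -[X in measurable X]setTI; exact: mX.
have mG : G `<=` measurable.
  move=> _ [D [mD _ ->]].
  apply: fin_bigcap_measurable => //.
  by move=> i _; exact: mXA.
have sG : <<s other_events i0 >> `<=` <<s G >>.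
  apply: smallest_sub; first exact: smallest_sigma_algebra.
  move=> _ [i ii0 [D mD <-]]; apply: sub_sigma_algebra.
  exists (fun j => if j == i then D else setT); split.
  - by move=> j; case: ifP.
  - by rewrite eq_sym (negbTE ii0).
  - rewrite setTI; apply/seteqP; split => w /=.
      by move=> Dw j _; case: ifP => [/eqP->|].
    by move=> /(_ i Logic.I); rewrite eqxx.
move=> /sG; move: B.
have PA : P (X i0 @^-1` A) = (fine (P (X i0 @^-1` A)))%:E.
  by rewrite fineK// fin_num_measure//; exact: mXA.
have nn : 0 <= fine (P (X i0 @^-1` A)) by exact: fine_ge0.
(* The two measures are [P] restricted to the event of [X i0], and [P] scaled by the probability of
   that event. *)
pose m2 := mscale (NngNum nn) P.
have m2E B : m2 B = (P (X i0 @^-1` A) * P B)%E by rewrite [in RHS]PA.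
have mA' : measurable (X i0 @^-1` A) by exact: mXA.
suff: forall B, <<s G >> B -> mrestr P mA' B = m2 B.
  by move=> H B GB; rewrite -m2E setIC; exact: H.
have setT_bigcap : [set: Omega] = \bigcap_(i : I) (X i @^-1` setT).
  by rewrite (_ : (fun _ => _) = (fun=> setT))// bigcapT.
apply: (@g_sigma_algebra_measure_unique _ _ _ G mG (fun=> setT)) => //.
- by move=> _; exists (fun=> setT); split.
- by rewrite bigcup_const.
- move=> _ _ [D [mD D0 ->]] [E [mE E0 ->]].
  exists (fun i => D i `&` E i); split.
  + by move=> i; exact: measurableI.
  + by rewrite D0 E0 setIT.
  + by rewrite -bigcapI.
- move=> _ [D [mD D0 ->]].
  rewrite -[RHS]/(m2 _) m2E -[LHS]/(P (_ `&` X i0 @^-1` A)).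
  have -> : \bigcap_i (X i @^-1` D i) `&` (X i0 @^-1` A) =
      \bigcap_i (X i @^-1` (if i == i0 then A else D i)).
    apply/seteqP; split => w /=.
      by move=> [Dw Aw] i _; case: ifP => [/eqP->//|_]; exact: Dw.
    move=> H; split; last by have := H i0 Logic.I; rewrite eqxx.
    move=> i _; have := H i Logic.I; case: ifP => // /eqP -> _.
    by rewrite D0.
  rewrite !indep//; last by move=> i; case: ifP.
  rewrite (bigD1 i0)//= eqxx; congr (_ * _)%E.
  rewrite [in RHS](bigD1 i0)//= D0 preimage_setT probability_setT mul1e.
  by apply: eq_bigr => i /negbTE ->.
- move=> k; rewrite /= /mrestr setTI.
  by rewrite (le_lt_trans (probability_le1 _ _))// ltry.
Qed.

End Freezing.

(** * Gaussian integrals *)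

Section NormalIntegrals.
Context {R : realType}.
Implicit Types (s m a mu v r : R).

(** Change of variables involves the Radon-Nikodym derivative, which is determined only almost
    everywhere; it agrees with the density because both have the same integral over every measurable
    set. *)
Lemma ge0_integral_normal_prob m s (f : R -> \bar R) :
  measurable_fun setT f -> (forall x, 0 <= f x)%E ->
  (\int[normal_prob m s]_x f x =
   \int[lebesgue_measure]_x (f x * (normal_pdf m s x)%:E))%E.
Proof.
move=> mf f0.
have dom := normal_prob_dominates m s.
have mpdf : measurable_fun setT (fun x => (normal_pdf m s x)%:E).
  by apply/measurable_EFinP; exact: measurable_normal_pdf.
have := Radon_Nikodym_SigmaFinite.change_of_variables dom f0 measurableT mf.
move=> /= <-.
have gint := Radon_Nikodym_SigmaFinite.f_integrable dom.
apply: ge0_ae_eq_integral => //.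
- by apply: emeasurable_funM => //; exact: measurable_int gint.
- exact: emeasurable_funM.
- by move=> x _; rewrite mule_ge0// Radon_Nikodym_SigmaFinite.f_ge0.
- by move=> x _; rewrite mule_ge0// lee_fin normal_pdf_ge0.
- apply: ae_eqe_mul2l; apply: integral_ae_eq => //.
  by move=> E _ mE; rewrite -Radon_Nikodym_SigmaFinite.f_integral.
Qed.

(** Completing the square turns each integrand below into a multiple of another Gaussian density,
    whose total mass is one. *)
Lemma integral_normal_prob_tilt s m' s' c (F : R -> R) :
  measurable_fun setT F -> (forall x, 0 <= F x) -> 0 <= c ->
  (forall x, F x * normal_pdf 0 s x = c * normal_pdf m' s' x) ->
  (\int[normal_prob 0 s]_x (F x)%:E = c%:E)%E.
Proof.
move=> mF F0 c0 FE; rewrite ge0_integral_normal_prob;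
  [|exact/measurable_EFinP|by move=> x; rewrite lee_fin].
under eq_integral do rewrite -EFinM FE EFinM.
rewrite ge0_integralZl//; first by rewrite integral_normal_pdf mule1.
- by apply/measurable_EFinP; exact: measurable_normal_pdf.
- by move=> x _; rewrite lee_fin normal_pdf_ge0.
Qed.

Lemma integral_normal_prob_expR s a : s != 0 ->
  (\int[normal_prob 0 s]_x (expR (a * x))%:E
   = (expR (a ^+ 2 * s ^+ 2 / 2))%:E)%E.
Proof.
move=> s0; apply: (@integral_normal_prob_tilt _ (a * s ^+ 2) s).
- by apply: measurableT_comp => //; exact: measurable_funM.
- by move=> x; exact: expR_ge0.
- exact: expR_ge0.
- move=> x; rewrite !normal_pdfE// /normal_fun mulrCA [RHS]mulrCA -!expRD.
  by congr (_ * expR _); field.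
Qed.

Lemma integral_normal_prob_expR_sqr s mu v r : s != 0 -> 0 <= mu ->
  let D := 1 + 2 * mu * s ^+ 2 * v ^+ 2 in
  (\int[normal_prob 0 s]_x (expR (- (mu * (v * x + r) ^+ 2)))%:E
   = ((Num.sqrt D)^-1 * expR (- (mu / D * r ^+ 2)))%:E)%E.
Proof.
move=> s0 mu0 D.
have D0 : 0 < D.
  apply: (lt_le_trans ltr01); rewrite /D lerDl.
  by rewrite mulr_ge0 ?sqr_ge0// mulr_ge0 ?sqr_ge0// mulr_ge0.
have sD0 : 0 < Num.sqrt D by rewrite sqrtr_gt0.
have s'0 : s / Num.sqrt D != 0 by rewrite mulf_neq0// invr_eq0 gt_eqF.
(* The quadratic coefficient [1 / (2 s^2) + mu v^2] equals [D / (2 s^2)]: the variance shrinks by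
   the factor [D], and the linear term [- 2 mu v r x] fixes the new mean. *)
apply: (@integral_normal_prob_tilt _ (- (2 * mu * v * r * s ^+ 2 / D))
  (s / Num.sqrt D)).
- apply: measurableT_comp => //; apply: measurableT_comp => //.
  apply: measurable_funM => //; apply: measurable_funX => //.
  by apply: measurable_funD => //; exact: measurable_funM.
- by move=> x; exact: expR_ge0.
- by rewrite mulr_ge0 ?expR_ge0// invr_ge0 ltW.
- move=> x; rewrite !normal_pdfE// /normal_peak /normal_fun.
  have -> : (s / Num.sqrt D) ^+ 2 = s ^+ 2 / D.
    by rewrite exprMn exprVn sqr_sqrtr// ltW.
  have -> : Num.sqrt (s ^+ 2 / D * pi *+ 2) =
      Num.sqrt (s ^+ 2 * pi *+ 2) / Num.sqrt D.
    rewrite -sqrtrV ?ltW// -sqrtrM; last first.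
      by rewrite mulrn_wge0// mulr_ge0 ?sqr_ge0// pi_ge0.
    by congr Num.sqrt; ring.
  rewrite mulrCA -expRD invf_div [RHS]mulrACA -expRD mulKf ?gt_eqF//.
  congr (_ * expR _); rewrite /D; field.
  rewrite -/D s0 /= gt_eqF//.
Qed.

End NormalIntegrals.

(** * Families of independent centred Gaussians *)

Section GaussianFamily.
Context {dO : measure_display} {Omega : measurableType dO} {R : realType}.
Variable P : probability Omega R.
Variables (I : finType) (X : I -> Omega -> R) (s : R).
Hypothesis s0 : s != 0.
Hypothesis mX : forall i, measurable_fun setT (X i).
Hypothesis lawX : forall i (A : set R), measurable A ->
  P (X i @^-1` A) = normal_prob 0 s A.
Hypothesis indepX : independent_rvs P X.

(* [F] may depend on the other variables only, which is what measurability in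
   the second argument expresses. *)
Lemma integrate_out i0 (F : R -> Omega -> R) :
  measurable_fun [set: R * g_sigma_algebraType (other_events X i0)]
    (fun z => F z.1 z.2) -> (forall x w, 0 <= F x w) ->
  (\int[P]_w (F (X i0 w) w)%:E =
   \int[P]_w \int[normal_prob 0 s]_x (F x w)%:E)%E.
Proof.
move=> mF F0.
(* [T2] is [Omega] with the sigma-algebra of the other variables; the identity into it is a random
   variable independent of [X i0]. *)
pose T2 : measurableType _ := g_sigma_algebraType (other_events X i0).
have mid : measurable_fun setT (id : Omega -> T2).
  move=> _ A mA; rewrite setTI preimage_id.
  have := smallest_sub (@sigma_algebra_measurable _ Omega)
    (other_events_measurable mX (i0 := i0)).
  exact.
have := @integral_independent _ _ _ P _ _ R T2 (X i0) id (mX i0) mid.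
move=> /(_ _ (fun z => (F z.1 z.2)%:E)) /= ->; last 3 first.
- by move=> A B mA mB; apply: independent_other.
- exact/measurable_EFinP.
- by move=> z; rewrite lee_fin.
apply: eq_integral => w _.
pose X' : {mfun Omega >-> R} :=
  HB.pack (X i0) (isMeasurableFun.Build _ _ _ _ _ (mX i0)).
have mFw : measurable_fun [set: R] (fun x => F x w).
  exact: (measurableT_comp mF (pair2_measurable (w : T2))).
transitivity (\int[distribution P X']_x (F x w)%:E)%E.
  rewrite ge0_integral_distribution//; first exact/measurable_EFinP.
  by move=> x; rewrite lee_fin.
have mid' : measurable_fun setT (id : measurableTypeR R -> R).
  by move=> _ A mA; rewrite setTI.
pose id' : {mfun measurableTypeR R >-> R} :=
  HB.pack id (isMeasurableFun.Build _ _ _ _ _ mid').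
have := @ge0_integral_distribution _ _ _ _ R (normal_prob 0 s) id'
  (fun x => (F x w)%:E).
move=> /(_ _ _)/= <-; [|exact/measurable_EFinP|by move=> x; rewrite lee_fin].
by apply: eq_measure_integral => A mA _; exact: lawX.
Qed.

Lemma measurable_other_sum i0 (r : seq I) (p : pred I) (a : I -> R) :
  i0 \notin r ->
  measurable_fun [set: R * g_sigma_algebraType (other_events X i0)]
    (fun z => \sum_(i <- r | p i) a i * X i z.2).
Proof.
move=> i0r.
rewrite (_ : (fun _ => _) = (fun z => \sum_(i <- r)
    (if (i \in r) && p i then a i * X i z.2 else 0))); last first.
  by apply/funext => z; rewrite big_seq_cond big_mkcond.
apply: measurable_sum => i; case: (boolP ((i \in r) && p i)) => [/andP[ir _]|_] //.
have ii0 : i != i0 by apply: contraNneq i0r => <-.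
apply: measurable_funM => //.
have mo := @measurable_other _ _ R I X _ _ ii0.
exact: (measurableT_comp mo (@measurable_snd _ _ R _)).
Qed.

Lemma gaussian_mgf_seq (a : I -> R) (r : seq I) : uniq r ->
  (\int[P]_w (expR (\sum_(i <- r) a i * X i w))%:E =
   (expR (s ^+ 2 / 2 * \sum_(i <- r) a i ^+ 2))%:E)%E.
Proof.
elim: r => [_|i0 r IH /= /andP[i0r ur]].
  under eq_integral do rewrite big_nil expR0.
  by rewrite big_nil mulr0 expR0 integral_cst// mul1e; exact: probability_setT.
pose Y w := \sum_(i <- r) a i * X i w.
under eq_integral do rewrite big_cons.
rewrite (@integrate_out i0 (fun x w => expR (a i0 * x + Y w)))//; last 1 first.
  apply: measurableT_comp => //; apply: measurable_funD.
    exact: measurable_funM.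
  exact: measurable_other_sum.
transitivity (\int[P]_w
   ((expR (a i0 ^+ 2 * s ^+ 2 / 2))%:E * (expR (Y w))%:E))%E.
  apply: eq_integral => w _; rewrite -integral_normal_prob_expR//.
  rewrite -ge0_integralZr//.
    by apply: eq_integral => x _; rewrite expRD.
  by apply/measurable_EFinP/measurableT_comp => //; exact: measurable_funM.
rewrite ge0_integralZl//; last first.
  apply/measurable_EFinP/measurableT_comp => //.
  by apply: measurable_sum => i; exact: measurable_funM.
rewrite IH// -EFinM -expRD big_cons; congr (expR _)%:E; ring.
Qed.

Lemma gaussian_mgf (a : I -> R) :
  (\int[P]_w (expR (\sum_i a i * X i w))%:E =
   (expR (s ^+ 2 / 2 * \sum_i a i ^+ 2))%:E)%E.
Proof. exact/gaussian_mgf_seq/index_enum_uniq. Qed.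

(** The weight [mu] varies with the row so that the induction closes: integrating out one entry
    divides the weight of its row by [D] and produces a factor [D^(-1/2)], and [D * (1 + 2 (mu / D)
    s^2 V) = D + 2 mu s^2 V] restores the form for the longer list. *)
Lemma gaussian_sqr_laplace_seq (K : finType) (row : I -> K) (v : I -> R)
    (r : seq I) (mu : K -> R) : uniq r -> (forall k, 0 <= mu k) ->
  (\int[P]_w (expR (- \sum_k
      mu k * (\sum_(i <- r | row i == k) v i * X i w) ^+ 2))%:E =
   (\prod_k (Num.sqrt (1 + 2 * mu k * s ^+ 2 *
      \sum_(i <- r | row i == k) v i ^+ 2))^-1)%:E)%E.
Proof.
elim: r mu => [|i0 r IH] mu /=.
  move=> _ _; under eq_integral.
    move=> w _; rewrite big1 ?oppr0 ?expR0; last first.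
      by move=> k _; rewrite big_nil expr0n mulr0.
    over.
  rewrite integral_cst// mul1e [LHS]probability_setT big1// => k _.
  by rewrite big_nil mulr0 addr0 sqrtr1 invr1.
move=> /andP[i0r ur] mu0.
pose k0 := row i0.
pose Y k w := \sum_(i <- r | row i == k) v i * X i w.
pose Z w := \sum_(k | k != k0) mu k * Y k w ^+ 2.
have sumE w : \sum_k mu k * (\sum_(i <- i0 :: r | row i == k) v i * X i w) ^+ 2
    = mu k0 * (v i0 * X i0 w + Y k0 w) ^+ 2 + Z w.
  rewrite (bigD1 k0)//= big_cons eqxx; congr (_ + _).
  apply: eq_bigr => k kk0; rewrite big_cons ifN//.
  by rewrite eq_sym.
under eq_integral do rewrite sumE.
have mY k : measurable_fun setT (Y k).
  rewrite (_ : Y k = fun w => \sum_(i <- r)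
      (if row i == k then v i * X i w else 0)); last first.
    by apply/funext => w; rewrite /Y big_mkcond.
  by apply: measurable_sum => i; case: eqP => // _; exact: measurable_funM.
rewrite (@integrate_out i0 (fun x w =>
  expR (- (mu k0 * (v i0 * x + Y k0 w) ^+ 2 + Z w))))//; last first.
  apply: measurableT_comp => //; apply: measurableT_comp => //.
  apply: measurable_funD.
    apply: measurable_funM => //; apply: measurable_funX.
    apply: measurable_funD; first exact: measurable_funM.
    exact: measurable_other_sum.
  rewrite (_ : (fun _ => _) = (fun z => \sum_k
    (if k != k0 then mu k * Y k z.2 ^+ 2 else 0))); last first.
    by apply/funext => z; rewrite /Z big_mkcond.
  apply: measurable_sum => k; case: eqP => //= _.
  apply: measurable_funM => //; apply: measurable_funX.
  exact: measurable_other_sum.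
pose D := 1 + 2 * mu k0 * s ^+ 2 * v i0 ^+ 2.
have D1 : 1 <= D.
  rewrite /D lerDl mulr_ge0 ?sqr_ge0// mulr_ge0 ?sqr_ge0// mulr_ge0//.
have D0 : 0 < D by exact: lt_le_trans D1.
pose mu' k := if k == k0 then mu k0 / D else mu k.
have mu'0 k : 0 <= mu' k by rewrite /mu'; case: ifP => // _; rewrite divr_ge0// ltW.
have mu'E w : mu k0 / D * Y k0 w ^+ 2 + Z w = \sum_k mu' k * Y k w ^+ 2.
  rewrite [RHS](bigD1 k0)//= /mu' eqxx; congr (_ + _).
  by apply: eq_bigr => k /negbTE ->.
transitivity (\int[P]_w (((Num.sqrt D)^-1)%:E *
    (expR (- \sum_k mu' k * Y k w ^+ 2))%:E))%E.
  apply: eq_integral => w _.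
  rewrite -mu'E opprD expRD -EFinM mulrA EFinM.
  have := @integral_normal_prob_expR_sqr R s (mu k0) (v i0) (Y k0 w) s0 (mu0 k0).
  rewrite /= -/D => <-; rewrite -ge0_integralZr//.
    by apply: eq_integral => x _; rewrite opprD expRD.
  apply/measurable_EFinP/measurableT_comp => //; apply: measurableT_comp => //.
  apply: measurable_funM => //; apply: measurable_funX => //.
  by apply: measurable_funD => //; exact: measurable_funM.
rewrite ge0_integralZl//; last first.
  apply/measurable_EFinP/measurableT_comp => //; apply: measurableT_comp => //.
  apply: measurable_sum => k; apply: measurable_funM => //.
  exact: measurable_funX.
rewrite IH// -EFinM; congr (_%:E).
rewrite (bigD1 k0)//= [in RHS](bigD1 k0)//= mulrA; congr (_ * _); last first.
  apply: eq_bigr => k kk0; rewrite /mu' (negbTE kk0) big_cons ifN//.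
  by rewrite eq_sym.
rewrite /mu' eqxx big_cons eqxx -invfM -sqrtrM ?ltW//; congr (Num.sqrt _)^-1.
by rewrite /D; field; rewrite gt_eqF.
Qed.

End GaussianFamily.

Lemma expR_sub_sqr_le (R : realType) (x : R) : 0 <= x ->
  expR (x - x ^+ 2 / 2) <= 1 + x.
Proof.
move=> x0; have x10 : 0 < 1 + x by rewrite ltr_wpDr.
rewrite -ler_ln ?posrE ?expR_gt0// expRK.
(* Up to a constant this is [ln y - (y - 1) + (y - 1)^2 / 2], whose derivative [(y - 1)^2 / y] is
   nonnegative. *)
pose g (y : R) := ln y - y *+ 2 + y ^+ 2 / 2.
pose dg (y : R) := y^-1 - 1 *+ 2 + y.
have dgP (y : R) : 0 < y -> is_derive y 1 g (dg y).
  move=> y0; rewrite /g /dg.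
  have h1 := is_derive1_ln y0.
  by apply: is_derive_eq; rewrite /GRing.scale /=; field; rewrite gt_eqF.
have [| | |c cI] := @MVT_segment R g dg 1 (1 + x).
- by rewrite lerDl.
- move=> y; rewrite in_itv/= => /andP[y1 _]; apply: dgP.
  exact: lt_trans y1.
- apply: derivable_within_continuous => y.
  rewrite in_itv/= => /andP[y1 _]; apply: ex_derive; apply: dgP.
  exact: lt_le_trans y1.
rewrite /g ln1 => E.
have c0 : 0 < c by move: cI; rewrite in_itv/= => /andP[c1 _]; exact: lt_le_trans c1.
have dg0 : 0 <= dg c * (1 + x - 1).
  have -> : 1 + x - 1 = x by ring.
  rewrite mulr_ge0// /dg.
  have -> : c^-1 - 1 *+ 2 + c = (c - 1) ^+ 2 / c by field; rewrite gt_eqF.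
  by rewrite divr_ge0 ?sqr_ge0 ?ltW.
rewrite -E in dg0; lra.
Qed.

Lemma dotmx_mulmx (R : realType) n m (A : 'M[R]_(n, m)) (u : 'cV[R]_m) (v : 'cV[R]_n) :
  dot v (A *m u) = \sum_(ij : 'I_n * 'I_m) v ij.1 0 * u ij.2 0 * A ij.1 ij.2.
Proof.
rewrite -(pair_big xpredT xpredT (fun i j => v i 0 * u j 0 * A i j))/=.
apply: eq_bigr => i _; rewrite mxE mulr_sumr; apply: eq_bigr => j _; ring.
Qed.

(** * Exponential moments of one Gaussian sketch *)

Section GaussianMatrix.
Context {dO : measure_display} {Omega : measurableType dO} {R : realType}.
Variable P : probability Omega R.
Variables (l d : nat) (S : Omega -> 'M[R]_(l, d)).
Hypothesis l0 : (0 < l)%N.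
Hypothesis gS : scaled_gaussian_mx P S.

Let X (ij : 'I_l * 'I_d) w := S w ij.1 ij.2.
Let sd : R := Num.sqrt l%:R^-1.

Let sd_neq0 : sd != 0.
Proof. by rewrite gt_eqF// sqrtr_gt0 invr_gt0 ltr0n. Qed.

Let sd2 : sd ^+ 2 = l%:R^-1.
Proof. by rewrite sqr_sqrtr// invr_ge0 ler0n. Qed.

Lemma scaled_gaussian_mgf (v : 'cV[R]_l) (u : 'cV[R]_d) (lam : R) :
  (\int[P]_w (expR (lam * dot v (S w *m u)))%:E
   = (expR (lam ^+ 2 / (2 * l%:R) * (dot v v * dot u u)))%:E)%E.
Proof.
have [mS lawS indS] := gS.
have H := @gaussian_mgf _ _ _ P _ X _ sd_neq0 (fun ij => mS ij.1 ij.2)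
  (fun ij A mA => lawS ij.1 ij.2 A mA) indS
  (fun ij => lam * (v ij.1 0 * u ij.2 0)).
under eq_integral do rewrite dotmx_mulmx mulr_sumr.
under eq_integral do under eq_bigr do rewrite mulrA.
rewrite H sd2; congr (expR _)%:E.
have -> : dot v v * dot u u = \sum_(ij : 'I_l * 'I_d) (v ij.1 0 * u ij.2 0) ^+ 2.
  rewrite -(pair_big xpredT xpredT (fun i j => (v i 0 * u j 0) ^+ 2))/=.
  rewrite /dot mulr_suml; apply: eq_bigr => i _; rewrite mulr_sumr.
  by apply: eq_bigr => j _; ring.
under eq_bigr do rewrite exprMn.
by rewrite -mulr_sumr; field; rewrite pnatr_eq0 -lt0n.
Qed.

Lemma scaled_gaussian_sqr_laplace (u : 'cV[R]_d) (mu : R) : 0 <= mu ->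
  (\int[P]_w (expR (- (mu * dot (S w *m u) (S w *m u))))%:E
   = ((Num.sqrt (1 + 2 * mu / l%:R * dot u u))^-1 ^+ l)%:E)%E.
Proof.
move=> mu0; have [mS lawS indS] := gS.
have H := @gaussian_sqr_laplace_seq _ _ _ P _ X _ sd_neq0
  (fun ij => mS ij.1 ij.2)
  (fun ij A mA => lawS ij.1 ij.2 A mA) indS _ fst (fun ij => u ij.2 0)
  _ (fun=> mu) (index_enum_uniq _) (fun=> mu0).
have rowE (F : 'I_l * 'I_d -> R) k :
    \sum_(i | i.1 == k) F i = \sum_j F (k, j).
  transitivity (\sum_(i | i == k) \sum_j F (i, j)); last by rewrite big_pred1_eq.
  rewrite pair_big_dep/=; apply: eq_big => [[i j]|[i j] _] //=.
  by rewrite andbT.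
transitivity (\int[P]_w (expR (- \sum_(k < l)
    mu * (\sum_(i | i.1 == k) u i.2 0 * X i w) ^+ 2))%:E)%E.
  apply: eq_integral => w _; congr (expR (- _))%:E.
  rewrite /dot mulr_sumr; apply: eq_bigr => k _; congr (_ * _).
  rewrite rowE -expr2 mxE; congr (_ ^+ 2).
  by apply: eq_bigr => j _; rewrite mulrC.
rewrite H; congr (_%:E).
transitivity (\prod_(k < l) (Num.sqrt (1 + 2 * mu / l%:R * dot u u))^-1).
  by apply: eq_bigr => k _; rewrite rowE sd2.
by rewrite prodr_const card_ord.
Qed.

(* The optimal Chernoff exponent is [l * eps / (2 * (1 - eps))]; [l * eps / 2]
   already yields the rate [eps ^ 2 / 4]. *)
Lemma scaled_gaussian_lower_tail (u : 'cV[R]_d) (eps : R) :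
  dot u u = 1 -> 0 <= eps ->
  (\int[P]_w (expR (l%:R * eps / 2 *
      (1 - eps - dot (S w *m u) (S w *m u))))%:E
   <= (expR (- (l%:R * eps ^+ 2 / 4)))%:E)%E.
Proof.
move=> u1 eps0; have [mS _ _] := gS.
have lR0 : (0 : R) < l%:R by rewrite ltr0n.
have mu0 : 0 <= l%:R * eps / 2 by rewrite divr_ge0// mulr_ge0// ltW.
under eq_integral do rewrite mulrBr expRD EFinM.
rewrite ge0_integralZl//; last first.
  apply/measurable_EFinP/measurableT_comp => //; apply: measurableT_comp => //.
  apply: measurable_funM => //; apply: measurable_sum => i.
  have m1 : measurable_fun setT (fun w => (S w *m u) i 0).
    under eq_fun do rewrite mxE.
    by apply: measurable_sum => j; apply: measurable_funM.
  exact: measurable_funM.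
rewrite scaled_gaussian_sqr_laplace// u1 mulr1 -EFinM lee_fin.
have -> : 2 * (l%:R * eps / 2) / l%:R = eps by field; rewrite gt_eqF.
have -> : - (l%:R * eps ^+ 2 / 4) =
    l%:R * eps / 2 * (1 - eps) + l%:R * - ((eps - eps ^+ 2 / 2) / 2) by field.
rewrite [leRHS]expRD ler_wpM2l ?expR_ge0//.
rewrite [l%:R * _]mulrC expRM_natr lerXn2r ?nnegrE ?expR_ge0 ?invr_ge0 ?sqrtr_ge0//.
rewrite expRN lef_pV2 ?posrE ?expR_gt0 ?sqrtr_gt0 ?ltr_pwDl//.
rewrite -(@ler_pXn2r _ 2) ?nnegrE ?expR_ge0 ?sqrtr_ge0//.
rewrite sqr_sqrtr ?addr_ge0// -expRM_natr divfK//.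
exact: expR_sub_sqr_le.
Qed.

End GaussianMatrix.

(** * Operator norm of a Gaussian matrix *)

Section Coins.
Context {R : realType}.

(** The left side is the relative entropy of a sign with mean [m] with respect to a fair sign. Its
    leading term [m^2 / 2] must keep its exact constant, since it determines the constant of the
    operator norm bound; only the relative error is estimated crudely. *)
Lemma coin_entropy_le (m : R) : `|m| <= 2^-1 ->
  (1 + m) / 2 * ln (1 + m) + (1 - m) / 2 * ln (1 - m)
    <= m ^+ 2 / 2 * (1 + 4 * `|m|).
Proof.
wlog m0 : m / 0 <= m.
  move=> H; have [/H//|/ltW m0] := leP 0 m; rewrite -normrN => mle.
  have := H (- m); rewrite oppr_ge0 => /(_ m0 mle).
  by rewrite opprK sqrrN addrC normrN.
rewrite ger0_norm// => m2.
have m1 : 0 < 1 - m by lra.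
have m1' : 0 < 1 + m by lra.
have H1 : ln (1 + m) + ln (1 - m) <= - m ^+ 2.
  rewrite -lnM ?posrE//.
  have -> : (1 + m) * (1 - m) = 1 + - m ^+ 2 by ring.
  apply: le_ln1Dx; have : m ^+ 2 <= 2^-1 ^+ 2 by rewrite lerXn2r ?nnegrE ?invr_ge0.
  lra.
have H2 : ln (1 + m) - ln (1 - m) <= 2 * m / (1 - m).
  rewrite -ln_div ?posrE//.
  have -> : (1 + m) / (1 - m) = 1 + 2 * m / (1 - m) by field; rewrite gt_eqF.
  by apply: le_ln1Dx; rewrite (@lt_le_trans _ _ 0)// divr_ge0 ?mulr_ge0// ltW.
have -> : (1 + m) / 2 * ln (1 + m) + (1 - m) / 2 * ln (1 - m) =
    2^-1 * (ln (1 + m) + ln (1 - m)) + m / 2 * (ln (1 + m) - ln (1 - m)) by field.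
apply: (@le_trans _ _ (2^-1 * - m ^+ 2 + m / 2 * (2 * m / (1 - m)))).
  by rewrite lerD// ler_wpM2l// ?divr_ge0.
rewrite -subr_ge0.
have -> : m ^+ 2 / 2 * (1 + 4 * m) - (2^-1 * - m ^+ 2 + m / 2 * (2 * m / (1 - m)))
    = m ^+ 3 * (1 - 2 * m) / (1 - m) by field; rewrite gt_eqF.
rewrite divr_ge0 ?(ltW m1)// mulr_ge0 ?exprn_ge0//; lra.
Qed.

(* Gibbs' variational principle, one inequality: [rho] is the posterior and
   [L] the log-likelihood ratio of [rho] to the prior [rho * expR (- L)]. *)
Lemma gibbs_lower_bound (T : finType) (rho L X : T -> R) :
  (forall t, 0 <= rho t) -> \sum_t rho t = 1 ->
  expR (\sum_t rho t * (X t - L t)) <= \sum_t rho t * expR (- L t) * expR (X t).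
Proof.
move=> rho0 rho1; set M := \sum_t _ * _.
(* Jensen's inequality by hand: [M] is the mean of [X - L], so the tangent of the exponential at [M]
   averages to [expR M]. *)
have -> : expR M = \sum_t rho t * (expR M * (1 + (X t - L t - M))).
  under eq_bigr do rewrite mulrCA mulrDr mulr1 mulrBr.
  rewrite -mulr_sumr big_split/= sumrB rho1 -mulr_suml rho1 mul1r.
  by rewrite -/M subrr addr0 mulr1.
apply: ler_sum => t _; rewrite -mulrA -expRD ler_wpM2l//.
have -> : - L t + X t = M + (X t - L t - M) by ring.
by rewrite expRD ler_wpM2l ?expR_ge0// expR_ge1Dx.
Qed.

Definition sgnb (b : bool) : R := if b then 1 else -1.

(** The joint law of independent signs with means [m i]. *)
Definition coin_weight (I : finType) (m : I -> R) (r : {ffun I -> bool}) : R :=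
  \prod_i ((1 + m i * sgnb (r i)) / 2).

Lemma coin_weight_prod (I : finType) (m : I -> R) (h : I -> bool -> R) :
  \sum_r coin_weight m r * \prod_i h i (r i) =
  \prod_i ((1 + m i) / 2 * h i true + (1 - m i) / 2 * h i false).
Proof.
transitivity (\sum_(r : {ffun I -> bool})
    \prod_i ((1 + m i * sgnb (r i)) / 2 * h i (r i))).
  by apply: eq_bigr => r _; rewrite big_split.
rewrite -(bigA_distr_bigA (fun i b => (1 + m i * sgnb b) / 2 * h i b)).
by apply: eq_bigr => i _; rewrite big_bool/= mulr1 mulrN1.
Qed.

Lemma coin_weight_sum (I : finType) (m : I -> R) : \sum_r coin_weight m r = 1.
Proof.
transitivity (\prod_i ((1 + m i) / 2 * 1 + (1 - m i) / 2 * 1)).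
  rewrite -(coin_weight_prod m (fun _ _ => 1)).
  by apply: eq_bigr => r _; rewrite big1// mulr1.
by rewrite big1// => i _; field.
Qed.

Lemma coin_weight_marginal (I : finType) (m : I -> R) i0 (g : bool -> R) :
  \sum_r coin_weight m r * g (r i0) =
  (1 + m i0) / 2 * g true + (1 - m i0) / 2 * g false.
Proof.
pose h i b := if i == i0 then g b else 1.
transitivity (\sum_r coin_weight m r * \prod_i h i (r i)).
  by apply: eq_bigr => r _; rewrite -big_mkcond big_pred1_eq.
rewrite coin_weight_prod /h (bigD1 i0)//= eqxx big1 ?mulr1// => i /negbTE ->.
by rewrite !mulr1; field.
Qed.

Lemma coin_weight_mean (I : finType) (m : I -> R) i :
  \sum_r coin_weight m r * sgnb (r i) = m i.
Proof. by rewrite (coin_weight_marginal m i sgnb)/= mulr1 mulrN1; field. Qed.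

Lemma coin_weight_mean2 (I : finType) (m : I -> R) i j :
  \sum_r coin_weight m r * (sgnb (r i) * sgnb (r j)) =
  if i == j then 1 else m i * m j.
Proof.
have [<-|ij] := eqVneq i j.
  rewrite (coin_weight_marginal m i (fun b => sgnb b * sgnb b))/=.
  by rewrite mulrNN mulr1; field.
pose h k b := (if k == i then sgnb b else 1) * (if k == j then sgnb b else 1).
transitivity (\sum_r coin_weight m r * \prod_k h k (r k)).
  by apply: eq_bigr => r _; rewrite big_split -!big_mkcond/= !big_pred1_eq.
rewrite coin_weight_prod /h (bigD1 i)//= eqxx (bigD1 j) 1?eq_sym//= eqxx.
rewrite eq_sym (negbTE ij) big1 => [|k /andP[/negbTE-> /negbTE->]].
  by field.
by field.
Qed.

Lemma coin_weight_ge0 (I : finType) (m : I -> R) r :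
  (forall i, `|m i| <= 1) -> 0 <= coin_weight m r.
Proof.
move=> m1; apply: prodr_ge0 => i _; rewrite divr_ge0//.
by have := m1 i; rewrite ler_norml /sgnb; case: ifP; lra.
Qed.

Definition coin_logratio (I : finType) (m : I -> R) (r : {ffun I -> bool}) : R :=
  \sum_i ln (1 + m i * sgnb (r i)).

(** Dividing the biased law by its likelihood ratio gives back the fair law; this removes the bias
    from the right side of Gibbs' inequality. *)
Lemma coin_logratioE (I : finType) (m : I -> R) r : (forall i, `|m i| < 1) ->
  coin_weight m r * expR (- coin_logratio m r) = 2^-1 ^+ #|I|.
Proof.
move=> m1; have pos i : 0 < 1 + m i * sgnb (r i).
  by have := m1 i; rewrite ltr_norml /sgnb; case: ifP; lra.
rewrite /coin_logratio -sumrN expR_sum.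
transitivity (\prod_i ((1 + m i * sgnb (r i)) / 2 *
    expR (- ln (1 + m i * sgnb (r i))))); first by rewrite big_split.
rewrite -prodr_const; apply: eq_bigr => i _.
by rewrite expRN lnK ?posrE//; field; rewrite gt_eqF.
Qed.

Lemma coin_logratio_mean (I : finType) (m : I -> R) (eta : R) : eta <= 2 ->
  (forall i, 4 * `|m i| <= eta) ->
  \sum_r coin_weight m r * coin_logratio m r
    <= (\sum_i m i ^+ 2) / 2 * (1 + eta).
Proof.
move=> eta2 meta; under eq_bigr do rewrite mulr_sumr.
rewrite exchange_big/= -mulrA mulr_suml ler_sum// => i _.
rewrite (coin_weight_marginal m i (fun b => ln (1 + m i * sgnb b)))/=.
rewrite mulr1 mulrN1; apply: le_trans (coin_entropy_le _) _.
  have := meta i; lra.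
by rewrite mulrA ler_wpM2l ?divr_ge0 ?sqr_ge0// lerD2l.
Qed.

(* Each coordinate is a scaled sum of [n] coins, which [coin_bias b u] biases so
   that the mean becomes [u]. *)
Definition coin_vec (k n : nat) (b : R) (r : {ffun 'I_k * 'I_n -> bool}) : 'cV[R]_k :=
  \col_i (b * \sum_j sgnb (r (i, j))).

Definition coin_bias (k n : nat) (b : R) (u : 'cV[R]_k) (ij : 'I_k * 'I_n) : R :=
  u ij.1 0 / (b * n%:R).

Lemma coin_vec_mean k n (b : R) (u : 'cV[R]_k) i : b != 0 -> (0 < n)%N ->
  \sum_r coin_weight (@coin_bias k n b u) r * coin_vec b r i 0 = u i 0.
Proof.
move=> b0 n0; under eq_bigr do rewrite mxE mulrCA mulr_sumr.
rewrite -mulr_sumr exchange_big/=.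
under eq_bigr do rewrite coin_weight_mean.
rewrite /coin_bias/= sumr_const card_ord -[_ *+ n]mulr_natr.
by field; rewrite pnatr_eq0 -lt0n n0 b0.
Qed.

(** The squared norm of the mean is [dot u u]; the rest is variance, at most [b^2] for each of the
    [n] coins of a coordinate. *)
Lemma coin_vec_mean_sqr k n (b : R) (u : 'cV[R]_k) : b != 0 -> (0 < n)%N ->
  \sum_r coin_weight (@coin_bias k n b u) r * dot (coin_vec b r) (coin_vec b r)
    <= dot u u + k%:R * (b ^+ 2 * n%:R).
Proof.
move=> b0 n0; rewrite /dot; under eq_bigr do rewrite mulr_sumr.
rewrite exchange_big/=.
have -> : k%:R * (b ^+ 2 * n%:R) = \sum_(i < k) (b ^+ 2 * n%:R) :> R.
  by rewrite sumr_const card_ord -[RHS]mulr_natl.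
rewrite -big_split/= ler_sum// => i _.
set wt := coin_weight _.
have key : \sum_r wt r * (\sum_(j < n) sgnb (r (i, j))) ^+ 2 <=
    (u i 0 / b) ^+ 2 + n%:R.
  have -> : \sum_r wt r * (\sum_(j < n) sgnb (r (i, j))) ^+ 2 =
     \sum_(j < n) \sum_(j' < n)
       \sum_r wt r * (sgnb (r (i, j)) * sgnb (r (i, j'))).
    transitivity (\sum_r \sum_(j < n) \sum_(j' < n)
        wt r * (sgnb (r (i, j)) * sgnb (r (i, j')))).
      apply: eq_bigr => r _; rewrite expr2 mulr_suml mulr_sumr.
      by apply: eq_bigr => j _; rewrite !mulr_sumr.
    rewrite exchange_big; apply: eq_bigr => j _ /=.
    by rewrite exchange_big.
  apply: (@le_trans _ _ (\sum_(j < n) \sum_(j' < n)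
      ((u i 0 / (b * n%:R)) ^+ 2 + (j == j')%:R))).
    rewrite ler_sum// => j _; rewrite ler_sum// => j' _.
    rewrite coin_weight_mean2 xpair_eqE eqxx /=.
    case: eqP => _; last by rewrite addr0 expr2.
    by rewrite lerDr sqr_ge0.
  under eq_bigr => j _.
    rewrite big_split/= sumr_const card_ord.
    rewrite (bigD1 j)//= eqxx big1 ?addr0; last first.
      by move=> j' /negbTE; rewrite eq_sym => ->.
    over.
  rewrite big_split/= !sumr_const card_ord lerD2r le_eqVlt; apply/orP; left.
  rewrite -[eqbLHS]mulr_natr -[X in X * _]mulr_natr; apply/eqP.
  by field; rewrite pnatr_eq0 -lt0n n0 b0.
have E r : wt r * (coin_vec b r i 0 * coin_vec b r i 0) =
    b ^+ 2 * (wt r * (\sum_(j < n) sgnb (r (i, j))) ^+ 2).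
  by rewrite !mxE; ring.
under eq_bigr do rewrite E.
rewrite -mulr_sumr -expr2; apply: le_trans (ler_wpM2l (sqr_ge0 b) key) _.
rewrite le_eqVlt; apply/orP; left; apply/eqP.
by field.
Qed.

End Coins.

Section CoinMgf.
Context {R : realType}.

(** A coordinate made of fair coins has variance [b^2 n = beta^-1]. To leading order the entropy of
    the bias is half this sum, hence [beta / 2], exactly the price of shifting a Gaussian prior of
    variance [beta^-1] by a unit vector. *)
Lemma coin_bias_sqr_sum k n (b beta : R) (u : 'cV[R]_k) :
  (0 < n)%N -> b ^+ 2 * n%:R * beta = 1 -> dot u u = 1 ->
  \sum_(ij : 'I_k * 'I_n) coin_bias b u ij ^+ 2 = beta.
Proof.
move=> n0 bE u1.
rewrite -(pair_big xpredT xpredT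
  (fun i j => coin_bias b u ((i, j) : 'I_k * 'I_n) ^+ 2))/=.
have b0 : b != 0.
  by apply: contra_eq_neq bE => ->; rewrite expr0n !mul0r eq_sym oner_neq0.
have beta0 : beta != 0.
  by apply: contra_eq_neq bE => ->; rewrite mulr0 eq_sym oner_neq0.
transitivity (\sum_(i < k) beta * (u i 0 * u i 0)); last first.
  by rewrite -mulr_sumr -/(dot u u) u1 mulr1.
apply: eq_bigr => i _; rewrite /coin_bias/= sumr_const card_ord -[LHS]mulr_natr.
rewrite -(mulr1_eq bE).
by field; rewrite pnatr_eq0 -lt0n n0 b0.
Qed.

Lemma coin_bias_small k n (b beta eta : R) (u : 'cV[R]_k) ij :
  (0 < n)%N -> b ^+ 2 * n%:R * beta = 1 -> dot u u = 1 -> 0 <= eta ->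
  16 * beta <= eta ^+ 2 * n%:R -> 4 * `|@coin_bias _ k n b u ij| <= eta.
Proof.
move=> n0 bE u1 eta0 H.
have nR : (0 : R) < n%:R by rewrite ltr0n.
have b0 : b != 0.
  by apply: contra_eq_neq bE => ->; rewrite expr0n !mul0r eq_sym oner_neq0.
have bb0 : 0 < b ^+ 2 by rewrite exprn_even_gt0.
have beta0 : 0 < beta by rewrite -(@pmulr_rgt0 _ (b ^+ 2 * n%:R)) ?bE// mulr_gt0.
rewrite -(@ler_pXn2r _ 2) ?nnegrE ?mulr_ge0// exprMn real_normK ?num_real//.
have ui : u ij.1 0 ^+ 2 <= 1.
  rewrite -u1 /dot (bigD1 ij.1)//= expr2 lerDl sumr_ge0// => i _.
  by rewrite -expr2 sqr_ge0.
apply: (@le_trans _ _ (16 * (beta / n%:R))); last first.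
  by rewrite mulrA ler_pdivrMr.
have -> : (4 : R) ^+ 2 = 16 by ring.
rewrite ler_wpM2l// /coin_bias.
have -> : (u ij.1 0 / (b * n%:R)) ^+ 2 = u ij.1 0 ^+ 2 * (beta / n%:R).
  by rewrite -(mulr1_eq bE); field; rewrite gt_eqF//= b0.
by rewrite ler_piMl// divr_ge0// ltW.
Qed.

Definition coin_mgf l d n (b b' lam : R) (A : 'M[R]_(l, d)) : R :=
  \sum_(rq : {ffun 'I_l * 'I_n -> bool} * {ffun 'I_d * 'I_n -> bool})
    2^-1 ^+ #|{: 'I_l * 'I_n}| * 2^-1 ^+ #|{: 'I_d * 'I_n}| *
    expR (lam * dot (coin_vec b rq.1) (A *m coin_vec b' rq.2)
      - lam ^+ 2 / (2 * l%:R) * (dot (coin_vec b rq.1) (coin_vec b rq.1)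
                                * dot (coin_vec b' rq.2) (coin_vec b' rq.2))).

Lemma coin_mgf_ge0 l d n (b b' lam : R) (A : 'M[R]_(l, d)) :
  0 <= coin_mgf n b b' lam A.
Proof.
apply: sumr_ge0 => rq _.
by rewrite mulr_ge0 ?expR_ge0// mulr_ge0// exprn_ge0// invr_ge0.
Qed.

Lemma bilinear_sum (T T' : finType) l d (rho : T -> R) (rho' : T' -> R)
    (v : T -> 'cV[R]_l) (z : T' -> 'cV[R]_d) (A : 'M[R]_(l, d))
    (u : 'cV[R]_l) (w : 'cV[R]_d) :
  (forall i, \sum_t rho t * v t i 0 = u i 0) ->
  (forall i, \sum_t rho' t * z t i 0 = w i 0) ->
  \sum_t \sum_t' rho t * rho' t' * dot (v t) (A *m z t') = dot u (A *m w).
Proof.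
move=> ru rw; rewrite [RHS]dotmx_mulmx.
transitivity (\sum_t \sum_t' \sum_(ij : 'I_l * 'I_d)
    (rho t * v t ij.1 0) * (rho' t' * z t' ij.2 0) * A ij.1 ij.2).
  apply: eq_bigr => t _; apply: eq_bigr => t' _.
  by rewrite dotmx_mulmx mulr_sumr; apply: eq_bigr => ij _; ring.
under eq_bigr do rewrite exchange_big/=.
rewrite exchange_big/=; apply: eq_bigr => ij _.
rewrite -ru -rw !mulr_suml; apply: eq_bigr => t _.
by rewrite -mulr_suml mulr_sumr.
Qed.

(** Gibbs' inequality with the product of two biased laws as posterior. Independence turns the mean
    of the product of squared norms into a product of means, bilinearity yields [dot u (A *m w)],
    and the two entropies add up. *)
Lemma coin_mgf_lower l d n (b b' beta beta' eta lam : R) (A : 'M[R]_(l, d))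
    (u : 'cV[R]_l) (w : 'cV[R]_d) :
  (0 < l)%N -> (0 < n)%N -> 0 < eta < 2 ->
  b ^+ 2 * n%:R * beta = 1 -> b' ^+ 2 * n%:R * beta' = 1 ->
  16 * beta <= eta ^+ 2 * n%:R -> 16 * beta' <= eta ^+ 2 * n%:R ->
  dot u u = 1 -> dot w w = 1 ->
  expR (lam * dot u (A *m w)
    - lam ^+ 2 / (2 * l%:R) * ((1 + l%:R / beta) * (1 + d%:R / beta'))
    - (beta + beta') / 2 * (1 + eta)) <= coin_mgf n b b' lam A.
Proof.
move=> l0 n0 /andP[eta0 eta2] bE bE' sm sm' u1 w1.
have b0 : b != 0.
  by apply: contra_eq_neq bE => ->; rewrite expr0n !mul0r eq_sym oner_neq0.
have b0' : b' != 0.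
  by apply: contra_eq_neq bE' => ->; rewrite expr0n !mul0r eq_sym oner_neq0.
pose m := @coin_bias _ l n b u; pose m' := @coin_bias _ d n b' w.
have msm ij : 4 * `|m ij| <= eta by apply: coin_bias_small bE _ _ _ => //; exact: ltW.
have msm' ij : 4 * `|m' ij| <= eta by apply: coin_bias_small bE' _ _ _ => //; exact: ltW.
have m1 ij : `|m ij| < 1 by have := msm ij; lra.
have m1' ij : `|m' ij| < 1 by have := msm' ij; lra.
pose rho (rq : {ffun 'I_l * 'I_n -> bool} * {ffun 'I_d * 'I_n -> bool}) :=
  coin_weight m rq.1 * coin_weight m' rq.2.
have wt0 r : 0 <= coin_weight m r by apply: coin_weight_ge0 => i; exact: ltW.
have wt0' r : 0 <= coin_weight m' r by apply: coin_weight_ge0 => i; exact: ltW.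
pose L (rq : {ffun 'I_l * 'I_n -> bool} * {ffun 'I_d * 'I_n -> bool}) :=
  coin_logratio m rq.1 + coin_logratio m' rq.2.
pose q (r : {ffun 'I_l * 'I_n -> bool}) : R := dot (coin_vec b r) (coin_vec b r).
pose q' (r : {ffun 'I_d * 'I_n -> bool}) : R := dot (coin_vec b' r) (coin_vec b' r).
pose C := lam ^+ 2 / (2 * l%:R).
pose X (rq : {ffun 'I_l * 'I_n -> bool} * {ffun 'I_d * 'I_n -> bool}) :=
  lam * dot (coin_vec b rq.1) (A *m coin_vec b' rq.2) - C * (q rq.1 * q' rq.2).
have rho0 rq : 0 <= rho rq by rewrite mulr_ge0.
have rho1 : \sum_rq rho rq = 1.
  rewrite -(pair_big xpredT xpredT
    (fun r s => coin_weight m r * coin_weight m' s))/=.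
  under eq_bigr do rewrite -mulr_sumr coin_weight_sum mulr1.
  exact: coin_weight_sum.
have -> : coin_mgf n b b' lam A = \sum_rq rho rq * expR (- L rq) * expR (X rq).
  apply: eq_bigr => rq _; congr (_ * _).
  by rewrite opprD expRD mulrACA !coin_logratioE.
apply: le_trans (gibbs_lower_bound L X rho0 rho1); rewrite ler_expR.
have -> : \sum_rq rho rq * (X rq - L rq) =
   lam * dot u (A *m w)
   - C * ((\sum_r coin_weight m r * q r) * (\sum_r coin_weight m' r * q' r))
   - (\sum_r coin_weight m r * coin_logratio m r
     + \sum_r coin_weight m' r * coin_logratio m' r).
  transitivity (\sum_r \sum_s (lam * (coin_weight m r * coin_weight m' s *
     dot (coin_vec b r) (A *m coin_vec b' s))
     - C * ((coin_weight m r * q r) * (coin_weight m' s * q' s))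
     - ((coin_weight m r * coin_logratio m r) * coin_weight m' s
        + coin_weight m r * (coin_weight m' s * coin_logratio m' s)))).
    rewrite (pair_big xpredT xpredT)/=; apply: eq_bigr => -[r s] _ /=.
    by rewrite /rho /X /L/=; ring.
  under eq_bigr do rewrite !sumrB -!mulr_sumr big_split/= -!mulr_sumr
    coin_weight_sum mulr1.
  rewrite !sumrB big_split/= -!mulr_sumr -!mulr_suml coin_weight_sum mul1r.
  rewrite (@bilinear_sum _ _ _ _ _ _ _ _ _ u w)// => i;
    by rewrite coin_vec_mean.
have C0 : 0 <= C by rewrite divr_ge0 ?sqr_ge0// mulr_ge0.
have nR : (n%:R : R) != 0 by rewrite pnatr_eq0 -lt0n.
have be : 0 < beta.
  by rewrite -(@pmulr_rgt0 _ (b ^+ 2 * n%:R)) ?bE// mulr_gt0 ?ltr0n// exprn_even_gt0.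
have be' : 0 < beta'.
  by rewrite -(@pmulr_rgt0 _ (b' ^+ 2 * n%:R)) ?bE'// mulr_gt0 ?ltr0n// exprn_even_gt0.
have qle : \sum_r coin_weight m r * q r <= 1 + l%:R / beta.
  apply: le_trans (coin_vec_mean_sqr _ b0 n0) _.
  by rewrite u1 (mulr1_eq (x := beta) (y := b ^+ 2 * n%:R))// mulrC.
have qle' : \sum_r coin_weight m' r * q' r <= 1 + d%:R / beta'.
  apply: le_trans (coin_vec_mean_sqr _ b0' n0) _.
  by rewrite w1 (mulr1_eq (x := beta') (y := b' ^+ 2 * n%:R))// mulrC.
have dotge0 k (v : 'cV[R]_k) : 0 <= dot v v.
  by apply: sumr_ge0 => i _; rewrite -expr2 sqr_ge0.
rewrite lerB//.
- rewrite lerB// ler_wpM2l// ler_pM//; apply: sumr_ge0 => r _;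
    by rewrite mulr_ge0 ?wt0 ?wt0' ?dotge0.
- rewrite -[beta](coin_bias_sqr_sum n0 bE u1).
  rewrite -[beta'](coin_bias_sqr_sum n0 bE' w1) !mulrDl lerD//;
    by apply: coin_logratio_mean => //; exact: ltW.
Qed.

End CoinMgf.

(* [x], [y] and [q] stand for [sqrt l], [sqrt d] and [sqrt (2 ln (1 / delta))];
   the variances of the priors are [1 / (x * m)] and [1 / (y * m)], and [eta] is
   the relative loss due to using finitely many coins. *)
Lemma coin_params (R : realType) (x y q : R) : 0 < x -> 0 < y -> 0 < q ->
  exists m eta, [/\ 0 < m, 0 < eta < 2 &
    (1 + x / m) * (1 + y / m) * (m * (x + y) / 2 * (1 + eta) + q ^+ 2 / 2)
      <= (x + y + q) ^+ 2].
Proof.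
move=> x0 y0 q0; set a := x + y.
have a0 : 0 < a by rewrite addr_gt0.
(* The arithmetic-geometric mean inequality leaves [a = x + y] as the only dimension parameter. *)
have V (m : R) : 0 < m -> (1 + x / m) * (1 + y / m) <= (1 + a / (2 * m)) ^+ 2.
  move=> m0; rewrite -subr_ge0.
  have -> : (1 + a / (2 * m)) ^+ 2 - (1 + x / m) * (1 + y / m) =
    ((x - y) / (2 * m)) ^+ 2 by rewrite /a; field; rewrite gt_eqF.
  exact: sqr_ge0.
(* For [q = 0] and [eta = 0] the expression [(1 + a / (2 m))^2 * m a / 2] is smallest at
   [m = a / 2], with value [a^2]. This [m] still works while [q <= a], the cross term [2 a q] paying
   for [eta = q / a]. *)
have [qa|aq] := leP q a.
  exists (a / 2), (q / a); split.
  - by rewrite divr_gt0.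
  - rewrite divr_gt0//= (@le_lt_trans _ _ 1) ?ltr1n//.
    by rewrite ler_pdivrMr// mul1r.
  - have K0 : 0 <= a / 2 * a / 2 * (1 + q / a) + q ^+ 2 / 2.
      by rewrite addr_ge0 ?divr_ge0 ?sqr_ge0// !mulr_ge0 ?addr_ge0 ?invr_ge0 ?ltW// divr_gt0.
    apply: le_trans (ler_wpM2r K0 (V (a / 2) _)) _; first by rewrite divr_gt0.
    have -> : (1 + a / (2 * (a / 2))) ^+ 2 * (a / 2 * a / 2 * (1 + q / a) + q ^+ 2 / 2)
      = a ^+ 2 + a * q + 2 * q ^+ 2 by field; rewrite gt_eqF.
    by have := ler_wpM2r (ltW q0) qa; nra.
(* For large [q] the term [q^2 / 2] dominates and needs a prefactor below 2; [m = 2 a] makes it at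
   most [25 / 16]. *)
exists (a * 2), 4^-1; split; first by rewrite mulr_gt0.
- by apply/andP; split; lra.
- have K0 : 0 <= a * 2 * a / 2 * (1 + 4^-1) + q ^+ 2 / 2.
    by rewrite addr_ge0 ?divr_ge0 ?sqr_ge0// !mulr_ge0 ?addr_ge0 ?invr_ge0 ?ltW.
  apply: le_trans (ler_wpM2r K0 (V (a * 2) _)) _; first by rewrite mulr_gt0.
  have -> : (1 + a / (2 * (a * 2))) ^+ 2 * (a * 2 * a / 2 * (1 + 4^-1) + q ^+ 2 / 2)
    = 125 / 64 * a ^+ 2 + 25 / 32 * q ^+ 2 by field; rewrite gt_eqF.
  have H : 0 <= (q - a) * a by rewrite mulr_ge0 ?subr_ge0 ?ltW.
  by have := sqr_ge0 q; have := sqr_ge0 a; nra.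
Qed.

Lemma dot_ge0 (R : realType) n (v : 'cV[R]_n) : 0 <= dot v v.
Proof. by apply: sumr_ge0 => i _; rewrite -expr2 sqr_ge0. Qed.

Lemma dotZZ (R : realType) n (c : R) (v : 'cV[R]_n) :
  dot (c *: v) (c *: v) = c ^+ 2 * dot v v.
Proof.
by rewrite /dot mulr_sumr; apply: eq_bigr => i _; rewrite !mxE; ring.
Qed.

Lemma dot_trmx (R : realType) l d (A : 'M[R]_(l, d)) (u : 'cV[R]_l) (v : 'cV[R]_d) :
  dot (A^T *m u) v = dot u (A *m v).
Proof.
rewrite dotmx_mulmx.
rewrite -(pair_big xpredT xpredT (fun i j => u i 0 * v j 0 * A i j))/=.
rewrite exchange_big/=; apply: eq_bigr => j _.
by rewrite mxE mulr_suml; apply: eq_bigr => i _; rewrite mxE; ring.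
Qed.

Lemma dotZr (R : realType) n (c : R) (u v : 'cV[R]_n) :
  dot u (c *: v) = c * dot u v.
Proof. by rewrite /dot mulr_sumr; apply: eq_bigr => i _; rewrite mxE; ring. Qed.

Lemma dotZl (R : realType) n (c : R) (u v : 'cV[R]_n) :
  dot (c *: u) v = c * dot u v.
Proof. by rewrite /dot mulr_sumr; apply: eq_bigr => i _; rewrite mxE; ring. Qed.

Lemma dot_normalize (R : realType) n (v : 'cV[R]_n) : dot v v != 0 ->
  dot ((Num.sqrt (dot v v))^-1 *: v) ((Num.sqrt (dot v v))^-1 *: v) = 1.
Proof. by move=> v0; rewrite dotZZ exprVn sqr_sqrtr ?dot_ge0// mulVf. Qed.

Lemma bilinear_bound_trmx (R : realType) l d (A : 'M[R]_(l, d)) (C : R) :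
  (forall u w, dot u u = 1 -> dot w w = 1 -> dot u (A *m w) <= C) ->
  0 <= C ->
  forall s, dot (A^T *m s) (A^T *m s) <= C ^+ 2 * dot s s.
Proof.
move=> H C0 s; set y := A^T *m s.
have [->|y0] := eqVneq (dot y y) 0; first by rewrite mulr_ge0 ?sqr_ge0 ?dot_ge0.
have s0 : dot s s != 0.
  apply: contra_neq y0 => ss0.
  have s0 : s = 0.
    apply/colP => i; rewrite mxE; apply/eqP; rewrite -sqrf_eq0 expr2.
    move/eqP: ss0; rewrite psumr_eq0; last by move=> j _; rewrite -expr2 sqr_ge0.
    by move/allP => /(_ i (mem_index_enum _)).
  by rewrite /y s0 mulmx0 /dot big1// => i _; rewrite mxE mul0r.
have yp : 0 < dot y y by rewrite lt_def y0 dot_ge0.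
have sp : 0 < dot s s by rewrite lt_def s0 dot_ge0.
(* The pair of directions [s] and [A^T *m s] attains the ratio of the two norms. *)
have := H _ _ (dot_normalize s0) (dot_normalize y0).
rewrite -scalemxAr dotZl dotZr -(dot_trmx A s y) -/y => HC.
have qy : 0 < Num.sqrt (dot y y) by rewrite sqrtr_gt0.
have qs : 0 < Num.sqrt (dot s s) by rewrite sqrtr_gt0.
have : Num.sqrt (dot y y) <= C * Num.sqrt (dot s s).
  rewrite -ler_pdivrMr//; apply: le_trans HC.
  rewrite -[X in _ * (_ * X)](sqr_sqrtr (ltW yp)) le_eqVlt; apply/orP; left.
  by apply/eqP; field; rewrite !gt_eqF.
rewrite -(@ler_pXn2r _ 2) ?nnegrE ?mulr_ge0 ?sqrtr_ge0//.
by rewrite exprMn !sqr_sqrtr// ltW.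
Qed.

(** All parameters are fixed before [A] is given, so for a random matrix the premise is a single
    event, of the kind Markov's inequality controls. *)
Lemma coin_mgf_opnorm (R : realType) l d (delta Smax : R) :
  (0 < l)%N -> (0 < d)%N -> 0 < delta < 1 ->
  Smax = 1 + Num.sqrt (d%:R / l%:R) + Num.sqrt (2 / l%:R * ln (1 / delta)) ->
  exists n b b' lam, forall A : 'M[R]_(l, d), coin_mgf n b b' lam A < delta^-1 ->
    forall s, dot (A^T *m s) (A^T *m s) <= 2 * Smax ^+ 2 * dot s s.
Proof.
move=> l0 d0 /andP[de0 de1] SmaxE.
have lR : (0 : R) < l%:R by rewrite ltr0n.
have dR : (0 : R) < d%:R by rewrite ltr0n.
set t := ln (1 / delta) in SmaxE.
have t0 : 0 < t by rewrite /t div1r ln_gt0// invf_gt1.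
pose x : R := Num.sqrt l%:R; pose y : R := Num.sqrt d%:R.
pose q := Num.sqrt (2 * t).
have x0 : 0 < x by rewrite sqrtr_gt0.
have y0 : 0 < y by rewrite sqrtr_gt0.
have q0 : 0 < q by rewrite sqrtr_gt0 mulr_gt0.
have SE : Smax = (x + y + q) / x.
  rewrite SmaxE !mulrDl divff ?gt_eqF//; congr (_ + _ + _).
    by rewrite sqrtrM ?ler0n// sqrtrV ?ler0n.
  rewrite /q /x -sqrtrV ?ler0n// -sqrtrM ?mulr_ge0 ?(ltW t0)//.
  by congr Num.sqrt; ring.
have [m [eta [m0 eta02 par]]] := coin_params x0 y0 q0.
have /andP[eta0 _] := eta02.
pose beta := x * m; pose beta' := y * m.
have be0 : 0 < beta by rewrite mulr_gt0.
have be0' : 0 < beta' by rewrite mulr_gt0.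
(* Enough coins for every bias to be at most [eta / 4], so that the entropy exceeds its leading term
   by a factor of at most [1 + eta]. *)
pose n := (Num.truncn (16 * (beta + beta') / eta ^+ 2)).+1.
have nR : (0 : R) < n%:R by rewrite ltr0n.
have nP : 16 * (beta + beta') <= eta ^+ 2 * n%:R.
  by rewrite [leRHS]mulrC -ler_pdivrMr ?exprn_gt0// ltW// truncnS_gt.
pose b := (Num.sqrt (n%:R * beta))^-1; pose b' := (Num.sqrt (n%:R * beta'))^-1.
have bE : b ^+ 2 * n%:R * beta = 1.
  rewrite /b exprVn sqr_sqrtr; last by rewrite mulr_ge0 ?ltW.
  by rewrite -mulrA mulVf// mulf_neq0 ?gt_eqF.
have bE' : b' ^+ 2 * n%:R * beta' = 1.
  rewrite /b' exprVn sqr_sqrtr; last by rewrite mulr_ge0 ?ltW.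
  by rewrite -mulrA mulVf// mulf_neq0 ?gt_eqF.
pose V := (1 + l%:R / beta) * (1 + d%:R / beta').
pose K := (beta + beta') / 2 * (1 + eta) + t.
have K0 : 0 < K by rewrite addr_gt0 ?mulr_gt0 ?addr_gt0 ?invr_gt0.
have V0 : 0 < V by rewrite mulr_gt0 ?addr_gt0 ?divr_gt0.
have KV : K * V <= l%:R * Smax ^+ 2.
  have -> : l%:R * Smax ^+ 2 = (x + y + q) ^+ 2.
    by rewrite SE -[l%:R](sqr_sqrtr (ltW lR)) -/x; field; rewrite gt_eqF.
  apply: le_trans par; rewrite le_eqVlt; apply/orP; left; apply/eqP.
  rewrite mulrC; congr (_ * _).
    rewrite /V /beta /beta' -[l%:R](sqr_sqrtr (ltW lR)) -/x.
    rewrite -[d%:R](sqr_sqrtr (ltW dR)) -/y; field.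
    by rewrite !gt_eqF.
  by rewrite /K /q sqr_sqrtr ?mulr_ge0 ?(ltW t0)// /beta /beta'; field.
(* The minimiser of [(K + lam^2 V / (2 l)) / lam]: both terms equal [K], and the resulting bound
   [2 K / lam] has square [2 K V / l], at most [2 Smax^2] by [KV]. *)
pose lam := Num.sqrt (2 * K * l%:R / V).
have lam0 : 0 < lam by rewrite sqrtr_gt0 divr_gt0// !mulr_gt0.
have lam2 : lam ^+ 2 = 2 * K * l%:R / V.
  by rewrite sqr_sqrtr// ltW// divr_gt0// !mulr_gt0.
have Sm0 : 0 < Smax by rewrite SE divr_gt0// !addr_gt0.
exists n, b, b', lam => A HA s.
have C0 : 0 <= Num.sqrt (2 * K * V / l%:R) by rewrite sqrtr_ge0.
have C2 : Num.sqrt (2 * K * V / l%:R) ^+ 2 = 2 * K * V / l%:R.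
  by rewrite sqr_sqrtr// ltW// divr_gt0// mulr_gt0// mulr_gt0.
apply: (@le_trans _ _ (Num.sqrt (2 * K * V / l%:R) ^+ 2 * dot s s)); last first.
  rewrite ler_wpM2r ?dot_ge0// C2 ler_pdivrMr//.
  by rewrite -mulrA -[leRHS]mulrA ler_pM2l// [leRHS]mulrC.
apply: bilinear_bound_trmx => // u w u1 w1.
have sm : 16 * beta <= eta ^+ 2 * n%:R by apply: le_trans nP; rewrite ler_pM2l// lerDl ltW.
have sm' : 16 * beta' <= eta ^+ 2 * n%:R by apply: le_trans nP; rewrite ler_pM2l// lerDr ltW.
have := le_lt_trans (coin_mgf_lower lam A l0 (ltn0Sn _) eta02 bE bE' sm sm' u1 w1) HA.
have -> : delta^-1 = expR t by rewrite /t div1r lnK// posrE invr_gt0.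
rewrite ltr_expR -/V => HL.
have L1 : lam ^+ 2 / (2 * l%:R) * V = K.
  by rewrite lam2; field; rewrite !gt_eqF.
have {}HL : lam * dot u (A *m w) <= 2 * K.
  rewrite L1 in HL; rewrite /K in HL *; lra.
apply: (@le_trans _ _ (2 * K / lam)); first by rewrite ler_pdivlMr// mulrC.
have KL0 : 0 <= 2 * K / lam by rewrite divr_ge0 ?(ltW lam0)// mulr_ge0// ltW.
rewrite -(@ler_pXn2r _ 2) ?nnegrE//.
rewrite C2 exprMn exprVn lam2 le_eqVlt; apply/orP; left; apply/eqP.
by field; rewrite !gt_eqF.
Qed.

Section MeasurableMatrix.
Context {dT : measure_display} {T : measurableType dT} {R : realType}.

Lemma measurable_mulmx l d k (A : T -> 'M[R]_(l, d)) (B : T -> 'M[R]_(d, k)) :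
  measurable_mx A -> measurable_mx B -> measurable_mx (fun w => A w *m B w).
Proof.
move=> mA mB i j; rewrite (_ : (fun _ => _) = fun w => \sum_k A w i k * B w k j).
  by apply: measurable_sum => h; exact: measurable_funM.
by apply/funext => w; rewrite mxE.
Qed.

Lemma measurable_dot n (u v : T -> 'cV[R]_n) :
  measurable_mx u -> measurable_mx v -> measurable_fun setT (fun w => dot (u w) (v w)).
Proof.
by move=> mu mv; apply: measurable_sum => i; exact: measurable_funM.
Qed.

Lemma measurable_mx_cst m n (A : 'M[R]_(m, n)) : measurable_mx (fun _ : T => A).
Proof. by move=> i j. Qed.

Lemma measurable_coin_mgf l d n (b b' lam : R) (A : T -> 'M[R]_(l, d)) :
  measurable_mx A -> measurable_fun setT (fun w => coin_mgf n b b' lam (A w)).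
Proof.
move=> mA; apply: measurable_sum => rq; apply: measurable_funM => //.
apply: measurableT_comp => //; apply: measurable_funB => //.
apply: measurable_funM => //; apply: measurable_dot.
  exact: measurable_mx_cst.
by apply: measurable_mulmx => //; exact: measurable_mx_cst.
Qed.

End MeasurableMatrix.

Lemma integral_coin_mgf {dO : measure_display} {Omega : measurableType dO}
    {R : realType} (P : probability Omega R) l d n (b b' lam : R)
    (S : Omega -> 'M[R]_(l, d)) : (0 < l)%N -> scaled_gaussian_mx P S ->
  (\int[P]_w (coin_mgf n b b' lam (S w))%:E = 1)%E.
Proof.
move=> l0 gS; have [mS _ _] := gS.
rewrite /coin_mgf; under eq_integral do rewrite -sumEFin.
set X := fun rq : {ffun 'I_l * 'I_n -> bool} * {ffun 'I_d * 'I_n -> bool} =>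
  (fun w => expR (lam * dot (coin_vec b rq.1) (S w *m coin_vec b' rq.2)) : R).
have mX rq : measurable_fun setT (X rq).
  apply: measurableT_comp => //; apply: measurable_funM => //.
  apply: measurable_dot; first exact: measurable_mx_cst.
  by apply: measurable_mulmx => //; exact: measurable_mx_cst.
have X0 rq w : 0 <= X rq w by exact: expR_ge0.
pose C (rq : {ffun 'I_l * 'I_n -> bool} * {ffun 'I_d * 'I_n -> bool}) : R :=
  lam ^+ 2 / (2 * l%:R) * (dot (coin_vec b rq.1) (coin_vec b rq.1)
    * dot (coin_vec b' rq.2) (coin_vec b' rq.2)).
pose c : R := 2^-1 ^+ #|{: 'I_l * 'I_n}| * 2^-1 ^+ #|{: 'I_d * 'I_n}|.
have c0 : 0 <= c by rewrite mulr_ge0// exprn_ge0// invr_ge0.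
rewrite ge0_integral_sum//; last first.
  move=> rq; apply/measurable_EFinP; apply: measurable_funM => //.
  apply: measurableT_comp => //; apply: measurable_funB => //.
  apply: measurable_funM => //; apply: measurable_dot.
    exact: measurable_mx_cst.
  by apply: measurable_mulmx => //; exact: measurable_mx_cst.
transitivity (\sum_(rq : {ffun 'I_l * 'I_n -> bool} * {ffun 'I_d * 'I_n -> bool})
    c%:E)%E.
  apply: eq_bigr => rq _.
  transitivity (\int[P]_w ((c * expR (- C rq))%:E * (X rq w)%:E))%E.
    apply: eq_integral => w _; rewrite -EFinM -[in RHS]mulrA /X -expRD.
    by congr (_ * expR _)%:E; rewrite /C addrC.
  rewrite ge0_integralZl//; [|exact/measurable_EFinP/mX| |]; last 2 first.
  - by move=> w _; rewrite lee_fin.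
  - by rewrite lee_fin mulr_ge0 ?expR_ge0.
  rewrite /X scaled_gaussian_mgf// -EFinM -[in RHS](mulr1 c) -[X in X%:E]mulrA.
  by congr (_ * _)%:E; rewrite -expRD /C addNr expR0.
transitivity ((\sum_(rq : {ffun 'I_l * 'I_n -> bool} *
    {ffun 'I_d * 'I_n -> bool}) c)%:E); first by rewrite -sumEFin.
congr (_%:E).
(* The fair law is the biased law with zero means. *)
have half (I : finType) : \sum_(r : {ffun I -> bool}) (2^-1 : R) ^+ #|I| = 1.
  rewrite -[RHS](coin_weight_sum (fun _ : I => 0 : R)).
  apply: eq_bigr => r _; rewrite /coin_weight -prodr_const.
  by apply: eq_bigr => i _; rewrite mul0r addr0 div1r.
rewrite -(pair_big xpredT xpredT (fun _ _ => c))/= /c.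
under eq_bigr do rewrite -mulr_sumr half mulr1.
exact: half.
Qed.

(** * Failure probability of a sketch given the past *)

Lemma measure_le_integral {d} {T : measurableType d} {R : realType}
    (mu : {measure set T -> \bar R}) (A : set T) (f : T -> R) :
  measurable A -> measurable_fun setT f -> (forall w, 0 <= f w) ->
  (forall w, A w -> 1 <= f w) -> (mu A <= \int[mu]_w (f w)%:E)%E.
Proof.
move=> mA mf f0 Af; rewrite -[A]setIT -integral_indic//.
apply: ge0_le_integral => //.
- exact/measurable_EFinP/measurable_indic.
- exact/measurable_EFinP.
- move=> w _; rewrite lee_fin indicE; case: (boolP (w \in A)) => //.
  by rewrite inE => /Af.
Qed.

Lemma measurable_bool_set {d} {T : measurableType d} (b : T -> bool) :
  measurable_fun setT b -> measurable [set w | b w].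
Proof.
by move=> mb; rewrite -[X in measurable X]setTI; exact: (mb measurableT [set true]).
Qed.

Section SketchFailure.
Context {dO : measure_display} {Omega : measurableType dO} {R : realType}.
Variable P : probability Omega R.
Variables (l d : nat) (S : Omega -> 'M[R]_(l, d)) (G : set (set Omega)).
Hypothesis l0 : (0 < l)%N.
Hypothesis gS : scaled_gaussian_mx P S.
Hypothesis mG : G `<=` measurable.
Hypothesis indep : independent_systems P <<s G >> <<s mx_events S >>.

Let TS : measurableType _ := g_sigma_algebraType (mx_events S).
Let TG : measurableType _ := g_sigma_algebraType G.

Lemma mx_events_measurable : mx_events S `<=` measurable.
Proof.
have [mS _ _] := gS.
by move=> _ [ij _ [B mB <-]]; exact: mS.
Qed.

Lemma measurable_mx_events : measurable_mx (S : TS -> 'M[R]_(l, d)).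
Proof.
move=> i j _ B mB; apply: sub_sigma_algebra.
by exists (i, j) => //; exists B.
Qed.

Lemma measurable_id_sigma (H : set (set Omega)) : H `<=` measurable ->
  measurable_fun setT (id : Omega -> g_sigma_algebraType H).
Proof.
move=> mH _ A mA; rewrite setTI preimage_id.
by have := smallest_sub (@sigma_algebra_measurable _ Omega) mH; apply.
Qed.

(** Exponential Markov inequality on the diagonal of [TS * TG], with the indicator of [A] in the
    past variable. Under the product law the inner integral sees a fixed unit direction, where the
    lower tail estimate applies. *)
Lemma sketch_tail_given_past (u : TG -> 'cV[R]_d) (eps : R) (A : set Omega) :
  measurable_mx u -> (forall w, dot (u w) (u w) = 1) -> 0 <= eps -> <<s G >> A ->
  (P (A `&` [set w | (dot (S w *m u w) (S w *m u w) < 1 - eps)%R])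
   <= (expR (- (l%:R * eps ^+ 2 / 4)))%:E * P A)%E.
Proof.
move=> mu u1 eps0 GA; have [mS _ _] := gS.
pose V (w1 : TS) (w2 : TG) : R :=
  l%:R * eps / 2 * (1 - eps - dot (S w1 *m u w2) (S w1 *m u w2)).
pose F (z : TS * TG) : R := \1_(A : set TG) z.2 * expR (V z.1 z.2).
have mA : measurable (A : set TG) by [].
have mAO : measurable A.
  by have := measurable_id_sigma mG measurableT mA; rewrite setTI.
have mSu : measurable_mx (fun z : TS * TG => S z.1 *m u z.2).
  apply: measurable_mulmx => i j.
    exact: (measurableT_comp (measurable_mx_events i j) measurable_fst).
  exact: (measurableT_comp (mu i j) measurable_snd).
have mV : measurable_fun [set: TS * TG] (fun z => V z.1 z.2).
  apply: measurable_funM => //; apply: measurable_funB => //.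
  exact: measurable_dot.
have mF : measurable_fun setT F.
  apply: measurable_funM; last exact: measurableT_comp.
  exact: (measurableT_comp (measurable_indic mA) measurable_snd).
have mid1 := measurable_id_sigma mx_events_measurable.
have mid2 := measurable_id_sigma mG.
have mdiag : measurable_fun setT (fun w : Omega => (w, w) : TS * TG).
  exact/measurable_fun_pair.
have F0 z : 0 <= F z by rewrite mulr_ge0 ?expR_ge0// indicE ler0n.
have mSuO : measurable_mx (fun w => S w *m (u : Omega -> 'cV[R]_d) w).
  by move=> i j; exact: (measurableT_comp (mSu i j) mdiag).
have mB : measurable [set w | (dot (S w *m u w) (S w *m u w) < 1 - eps)%R].
  apply: measurable_bool_set; apply: measurable_fun_ltr => //.
  exact: measurable_dot.
apply: (@le_trans _ _ (\int[P]_w (F (w, w))%:E)%E).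
  apply: measure_le_integral => //.
  - exact: measurableI.
  - exact: (measurableT_comp mF mdiag).
  - move=> w [Aw /= Bw]; rewrite /F /= indicE mem_set//= mul1r -expR0 ler_expR.
    by rewrite /V mulr_ge0 ?divr_ge0 ?mulr_ge0// subr_ge0 ltW.
have := @integral_independent _ _ _ P _ _ TS TG id id mid1 mid2.
move=> /(_ _ (fun z => (F z)%:E)) /= ->; last 3 first.
- by move=> B C mB' mC; rewrite setIC muleC; exact: indep.
- exact/measurable_EFinP.
- by move=> z; rewrite lee_fin.
apply: (@le_trans _ _ (\int[P]_w
   ((\1_A w)%:E * (expR (- (l%:R * eps ^+ 2 / 4)))%:E))%E).
  apply: ge0_le_integral => //.
  - by move=> w _; apply: integral_ge0 => w' _; rewrite lee_fin.
  - apply: (@measurable_partial_integral _ _ _ P _ _ TS TG id id mid1 mid2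
      (fun z => (F z)%:E)).
      exact/measurable_EFinP.
    by move=> z; rewrite lee_fin.
  - apply: emeasurable_funM => //.
    exact/measurable_EFinP/measurable_indic.
  - move=> w _; rewrite /F/=.
    under eq_integral do rewrite EFinM.
    rewrite ge0_integralZl//.
    + apply: lee_wpmul2l; first by rewrite lee_fin indicE ler0n.
      exact: scaled_gaussian_lower_tail.
    + apply/measurable_EFinP; apply: measurableT_comp => //.
      apply: measurable_funM => //; apply: measurable_funB => //.
      by apply: measurable_dot; apply: measurable_mulmx => //;
        exact: measurable_mx_cst.
rewrite ge0_integralZr//; last exact/measurable_EFinP/measurable_indic.
by rewrite integral_indic// setIT muleC.
Qed.

(** Only the norm of [S *m u] involves the past through [u] and needs freezing. The coin condition
    is an event of [S] alone: independence factors its probability, and Markov's inequality with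
    mean 1 bounds it by [delta]. *)
Lemma sketch_failure_given_past (n : nat) (b b' lam delta : R)
    (u : TG -> 'cV[R]_d) (eps : R) (A : set Omega) : 0 < delta ->
  measurable_mx u -> (forall w, dot (u w) (u w) = 1) -> 0 <= eps -> <<s G >> A ->
  (P (A `&` ~` [set w | (1 - eps <= dot (S w *m u w) (S w *m u w))%R
                        && (coin_mgf n b b' lam (S w) < delta^-1)%R])
   <= (expR (- (l%:R * eps ^+ 2 / 4)) + delta)%R%:E * P A)%E.
Proof.
move=> delta0 mu u1 eps0 GA; have [mS _ _] := gS.
have mAO : measurable A.
  by have := measurable_id_sigma mG measurableT GA; rewrite setTI.
pose B1 := [set w | (dot (S w *m u w) (S w *m u w) < 1 - eps)%R].
pose B2 := [set w | (delta^-1 <= coin_mgf n b b' lam (S w))%R].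
have mu' : measurable_mx (u : Omega -> 'cV[R]_d).
  move=> i j; exact: (measurableT_comp (mu i j) (measurable_id_sigma mG)).
have mB1 : measurable B1.
  apply: measurable_bool_set; apply: measurable_fun_ltr => //.
  by apply: measurable_dot; exact: measurable_mulmx.
have SB2 : <<s mx_events S >> B2.
  apply: (@measurable_bool_set _ TS); apply: measurable_fun_ler => //.
  apply: measurable_coin_mgf; exact: measurable_mx_events.
have mB2 : measurable B2.
  by have := measurable_id_sigma mx_events_measurable measurableT SB2; rewrite setTI.
have PB2 : (P B2 <= delta%:E)%E.
  have mc : measurable_fun setT (fun w => coin_mgf n b b' lam (S w)).
    exact: measurable_coin_mgf.
  have := @measure_le_integral _ _ _ P B2
    (fun w => delta * coin_mgf n b b' lam (S w)) mB2.
  move=> /(_ _ _ _) H; apply: (le_trans (H _ _ _)).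
  - exact: measurable_funM.
  - by move=> w; rewrite mulr_ge0 ?coin_mgf_ge0// ltW.
  - by move=> w; rewrite /B2/= -ler_pdivrMl// mulr1.
  - under eq_integral do rewrite EFinM.
    rewrite ge0_integralZl//.
    + by rewrite integral_coin_mgf// mule1.
    + exact/measurable_EFinP.
    + by move=> w _; rewrite lee_fin coin_mgf_ge0.
    + by rewrite lee_fin ltW.
apply: (@le_trans _ _ (P ((A `&` B1) `|` (A `&` B2)))).
  apply: le_measure; rewrite ?inE//.
  - apply: measurableI => //; apply: measurableC; apply: measurable_bool_set.
    apply: measurable_and; [apply: measurable_fun_ler|apply: measurable_fun_ltr] => //.
      by apply: measurable_dot; exact: measurable_mulmx.
    exact: measurable_coin_mgf.
  - by apply: measurableU; exact: measurableI.
  - move=> w [Aw] /= /negP; rewrite negb_and -ltNge -leNgt.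
    by move=> /orP[]; [left|right].
apply: (le_trans (measureU2 _ _ _)); [exact: measurableI|exact: measurableI|].
rewrite EFinD ge0_muleDl ?lee_fin ?expR_ge0 ?(ltW delta0)//.
rewrite leeD ?sketch_tail_given_past//.
apply: (@le_trans _ _ (P A * P B2)%E); last by rewrite muleC; exact: lee_wpmul2r.
by rewrite le_eqVlt; apply/orP; left; apply/eqP; exact: indep.
Qed.

End SketchFailure.

(** * Chernoff bound for adapted events *)

Lemma expR_ge1Dx_sqr (R : realType) (x : R) : 0 <= x -> 1 + x + x ^+ 2 / 2 <= expR x.
Proof.
move=> x0.
pose g (y : R) := expR y - y - y ^+ 2 / 2.
pose dg (y : R) := expR y - 1 - y.
have dgP (y : R) : is_derive y 1 g (dg y).
  by apply: is_derive_eq; rewrite /dg /GRing.scale /=; field.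
have [|c cI] := MVT_segment x0 (fun y _ => dgP y).
  by apply: derivable_within_continuous => y _; apply: ex_derive; exact: dgP.
rewrite /g expR0 => E.
have : 0 <= dg c * (x - 0).
  by rewrite subr0 mulr_ge0// /dg -addrA -opprD subr_ge0 expR_ge1Dx.
rewrite -E; lra.
Qed.

(** The reciprocal of the preceding bound suffices, as [(1 - x + x^2 / 2) * (1 + x + x^2 / 2) = 1 +
    x^4 / 4]. *)
Lemma expRN_le (R : realType) (x : R) : 0 <= x -> expR (- x) <= 1 - x + x ^+ 2 / 2.
Proof.
move=> x0; have H := expR_ge1Dx_sqr x0.
have p : 0 < 1 + x + x ^+ 2 / 2.
  by rewrite -addrA ltr_pwDl// addr_ge0 ?divr_ge0 ?sqr_ge0.
rewrite expRN (@le_trans _ _ (1 + x + x ^+ 2 / 2)^-1)//.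
  by rewrite lef_pV2 ?posrE ?expR_gt0.
rewrite -div1r ler_pdivrMr// -subr_ge0.
have -> : (1 - x + x ^+ 2 / 2) * (1 + x + x ^+ 2 / 2) - 1 = (x ^+ 2) ^+ 2 / 4 by field.
by rewrite divr_ge0 ?sqr_ge0.
Qed.

Section AdaptiveChernoff.
Context {dO : measure_display} {Omega : measurableType dO} {R : realType}.
Variable P : probability Omega R.
Variables (G : nat -> set (set Omega)) (E : nat -> set Omega) (q : R).
Hypothesis mG : forall k, G k `<=` measurable.
Hypothesis ndG : forall k, G k `<=` G k.+1.
Hypothesis GE : forall k, <<s G k.+1 >> (E k).
Hypothesis q01 : 0 <= q <= 1.
Hypothesis Eq : forall k A, <<s G k >> A -> (P (A `&` ~` E k) <= q%:E * P A)%E.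

Definition hits (m : nat) (w : Omega) : nat := \sum_(k < m) (w \in E k).

Let lev m j := [set w | hits m w = j].

Let levS m j : lev m.+1 j = (lev m j `&` ~` E m) `|`
  (if j is j'.+1 then lev m j' `&` E m else set0).
Proof.
apply/seteqP; split => w; rewrite /lev /= /hits big_ord_recr /=.
  case: (boolP (w \in E m)) => [wE|wE] /=.
    rewrite addn1 => <-; right; split => //; exact/set_mem.
  by rewrite addn0 => <-; left; split => //; move: wE; rewrite notin_setE.
move=> [[<- wE]|].
  by rewrite memNset// addn0.
by case: j => [//|j] [<- wE]; rewrite mem_set// addn1.
Qed.

Let sG k : <<s G k >> `<=` <<s G k.+1 >>.
Proof. by apply: sub_smallest2r; [exact: smallest_sigma_algebra|exact: ndG]. Qed.

Let Glev m j : <<s G m >> (lev m j).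
Proof.
elim: m j => [|m IH] j.
  have [->|j0] := eqVneq j 0%N.
    rewrite (_ : lev 0 0 = setT); first exact: (@measurableT _ (g_sigma_algebraType (G 0%N))).
    by apply/seteqP; split => // w _; rewrite /lev /= /hits big_ord0.
  rewrite (_ : lev 0 j = set0); first exact: sigma_algebra0.
  apply/seteqP; split => // w; rewrite /lev /= /hits big_ord0 => /eqP.
  by rewrite eq_sym (negbTE j0).
rewrite levS; pose T : measurableType _ := g_sigma_algebraType (G m.+1).
have mE : @measurable _ T (E m) by exact: GE.
have mL i : @measurable _ T (lev m i) by exact: sG.
apply: (@measurableU _ T); first by apply: measurableI => //; exact: measurableC.
by case: j => [|j]; [exact: measurable0|exact: measurableI].
Qed.

Let sub_meas k : <<s G k >> `<=` measurable.
Proof. by apply: smallest_sub; [exact: sigma_algebra_measurable|exact: mG]. Qed.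

Let mlev m j : measurable (lev m j). Proof. exact: (@sub_meas m _ (@Glev m j)). Qed.
Let mE k : measurable (E k). Proof. exact: (@sub_meas k.+1 _ (@GE k)). Qed.

Let p m j := fine (P (lev m j)).
Let a m j := fine (P (lev m j `&` ~` E m)).

Let Pfin A : measurable A -> P A = (fine (P A))%:E.
Proof. by move=> mA; rewrite fineK// fin_num_measure. Qed.

Let p_ge0 m j : 0 <= p m j. Proof. exact: fine_ge0. Qed.
Let a_ge0 m j : 0 <= a m j. Proof. exact: fine_ge0. Qed.

Let a_le m j : a m j <= q * p m j.
Proof.
have := Eq (@Glev m j).
rewrite (Pfin (mlev m j)) Pfin ?lee_fin//.
by apply: measurableI => //; exact: measurableC.
Qed.

Let pS m j : p m.+1 j <= a m j + (if j is j'.+1 then p m j' - a m j' else 0).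
Proof.
have mA i : measurable (lev m i `&` ~` E m).
  by apply: measurableI => //; exact: measurableC.
have mB i : measurable (lev m i `&` E m) by exact: measurableI.
have splitE i : p m i - a m i = fine (P (lev m i `&` E m)).
  apply/eqP; rewrite subr_eq; apply/eqP/EFin_inj.
  rewrite EFinD -!Pfin// -measureU//.
    by rewrite -setIUr setUv setIT.
  by rewrite setIACA setICr setI0.
rewrite -lee_fin -Pfin// levS; case: j => [|j].
  by rewrite setU0 addr0 -Pfin.
by rewrite splitE EFinD -!Pfin// measureU2.
Qed.

Let p_out m j : (m < j)%N -> p m j = 0.
Proof.
move=> mj; rewrite /p (_ : lev m j = set0) ?measure0//.
apply/seteqP; split => // w; rewrite /lev /= => H.
have : (hits m w <= m)%N.
  rewrite /hits (leq_trans (n := \sum_(k < m) 1))//.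
    by apply: leq_sum => k _; case: (_ \in _).
  by rewrite sum1_card card_ord.
by rewrite H leqNgt mj.
Qed.

(** The sum is the Laplace transform of [hits m]. In one more step a miss keeps the weight and a hit
    multiplies it by [e <= 1], so an upper bound on misses is all that matters and the transform
    grows by at most the factor [e + (1 - e) * q]. *)
Lemma hits_laplace m (t : R) : 0 <= t ->
  \sum_(j < m.+1) expR (- (t * j%:R)) * p m j
    <= (1 - (1 - expR (- t)) * (1 - q)) ^+ m.
Proof.
move=> t0; set e := expR (- t).
have e0 : 0 <= e by exact: expR_ge0.
have e1 : e <= 1 by rewrite -expR0 ler_expR oppr_le0.
have rho0 : 0 <= 1 - (1 - e) * (1 - q).
  by have /andP[q0 q1] := q01; nra.
elim: m => [|m IH].
  rewrite big_ord_recr big_ord0 /= add0r mulr0 oppr0 expR0 mul1r expr0.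
  by rewrite -lee_fin -Pfin// probability_le1.
rewrite exprS; apply: le_trans (ler_wpM2l rho0 IH); rewrite mulr_sumr.
have aout : a m m.+1 = 0.
  apply/eqP; rewrite eq_le a_ge0 andbT; apply: le_trans (a_le _ _) _.
  by rewrite p_out// mulr0.
apply: (@le_trans _ _ (\sum_(j < m.+2) expR (- (t * j%:R)) *
   (a m j + (if val j is j'.+1 then p m j' - a m j' else 0)))).
  by apply: ler_sum => j _; rewrite ler_wpM2l ?expR_ge0// pS.
under eq_bigr do rewrite mulrDr.
rewrite big_split/= big_ord_recr/= aout mulr0 addr0.
rewrite [X in _ + X]big_ord_recl/= mulr0 add0r -big_split/=.
apply: ler_sum => j _.
have -> : expR (- (t * (bump 0 j)%:R)) = expR (- (t * j%:R)) * e.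
  by rewrite /e -expRD /bump add1n -natr1; congr expR; ring.
rewrite -mulrA -mulrDr mulrCA ler_wpM2l ?expR_ge0//.
by have := a_le m j; have := a_ge0 m j; have := p_ge0 m j; nra.
Qed.

Lemma measurable_hits_le (N : nat) (r : R) :
  measurable [set w | ((hits N w)%:R <= r)%R].
Proof.
rewrite (_ : [set w | _] = \big[setU/set0]_(j < N.+1)
    (if (j%:R <= r)%R then lev N j else set0)).
  by apply: bigsetU_measurable => j _; case: ifP.
rewrite -(bigcup_mkord _ (fun j => if (j%:R <= r)%R then lev N j else set0)).
apply/seteqP; split => w /=.
  move=> wr; exists (hits N w) => /=; last by rewrite wr.
  rewrite ltnS /hits (leq_trans (n := \sum_(k < N) 1))//.
    by apply: leq_sum => k _; case: (_ \in _).
  by rewrite sum1_card card_ord.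
by move=> [j _] /=; case: ifP => // jr; rewrite /lev /= => ->.
Qed.

Theorem adaptive_chernoff (N : nat) (delta : R) : 0 <= delta ->
  (P [set w | ((hits N w)%:R <= (1 - delta) * (1 - q) * N%:R)%R] <=
   (expR (- (delta ^+ 2 / 2 * (1 - q) * N%:R)))%:E)%E.
Proof.
move=> d0; have /andP[q0 q1] := q01.
set r := (1 - delta) * (1 - q) * N%:R.
pose A j := if (j%:R <= r) then lev N j else set0.
have mA j : measurable (A j) by rewrite /A; case: ifP.
have sub : [set w | ((hits N w)%:R <= r)%R] `<=` \big[setU/set0]_(j < N.+1) A j.
  move=> w /= wr; rewrite -bigcup_mkord; exists (hits N w) => /=.
    rewrite ltnS /hits (leq_trans (n := \sum_(k < N) 1))//.
      by apply: leq_sum => k _; case: (_ \in _).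
    by rewrite sum1_card card_ord.
  by rewrite /A wr.
have mhit := measurable_hits_le N r.
apply: (@le_trans _ _ (\sum_(j < N.+1) P (A j))%E).
  apply: le_trans (Boole_inequality P (A := A) _) => //.
  apply: le_measure; rewrite ?inE//; exact: bigsetU_measurable.
(* The parameter [delta] replaces the optimal [- ln (1 - delta)]; it also makes sense for
   [delta >= 1] and gives the exponent [delta * (1 - delta) - (delta - delta^2 / 2) = - delta^2 /
   2]. *)
apply: (@le_trans _ _ (\sum_(j < N.+1) (expR (delta * (r - j%:R)) * p N j)%:E)%E).
  apply: lee_sum => j _; rewrite /A; case: ifP => [jr|_].
    rewrite Pfin// lee_fin ler_peMl ?fine_ge0//.
    by rewrite -[leLHS]expR0 ler_expR mulr_ge0// subr_ge0.
  by rewrite measure0 lee_fin mulr_ge0 ?expR_ge0.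
rewrite sumEFin lee_fin.
under eq_bigr do rewrite mulrBr expRD -mulrA.
rewrite -mulr_sumr; apply: le_trans (ler_wpM2l (expR_ge0 _) (hits_laplace N d0)) _.
set e := expR (- delta).
have e0 : 0 <= e by exact: expR_ge0.
have e1 : e <= 1 by rewrite -expR0 ler_expR oppr_le0.
have rho0 : 0 <= 1 - (1 - e) * (1 - q) by nra.
apply: (@le_trans _ _ (expR (delta * r) * expR (- ((1 - e) * (1 - q))) ^+ N)).
  rewrite ler_wpM2l ?expR_ge0// lerXn2r ?nnegrE ?expR_ge0//.
  by have := expR_ge1Dx (- ((1 - e) * (1 - q))); lra.
rewrite -expRM_natr -expRD ler_expR /r.
have H : delta - delta ^+ 2 / 2 <= 1 - e by have := expRN_le d0; rewrite -/e; lra.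
have : 0 <= (1 - e - (delta - delta ^+ 2 / 2)) * ((1 - q) * N%:R).
  by rewrite mulr_ge0 ?subr_ge0// mulr_ge0 ?subr_ge0.
lra.
Qed.

End AdaptiveChernoff.

(** * One iteration *)

Section Descent.
Context {R : realType}.

Lemma dotBl n (u v w : 'cV[R]_n) : dot (u - v) w = dot u w - dot v w.
Proof. by rewrite /dot -sumrB; apply: eq_bigr => i _; rewrite !mxE mulrBl. Qed.

Lemma norm2_ge0 n (v : 'cV[R]_n) : 0 <= norm2 v.
Proof. exact: sqrtr_ge0. Qed.

Lemma norm2_sqr n (v : 'cV[R]_n) : norm2 v ^+ 2 = dot v v.
Proof. by rewrite sqr_sqrtr// dot_ge0. Qed.

Lemma norm2Z n (c : R) (v : 'cV[R]_n) : norm2 (c *: v) = `|c| * norm2 v.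
Proof. by rewrite /norm2 dotZZ sqrtrM ?sqr_ge0// sqrtr_sqr. Qed.

Lemma cauchy_schwarz n (u v : 'cV[R]_n) : dot u v <= norm2 u * norm2 v.
Proof.
set a := norm2 u; set b := norm2 v.
have a0 : 0 <= a by exact: norm2_ge0.
have b0 : 0 <= b by exact: norm2_ge0.
have H : 0 <= 2 * (a * b) * (a * b - dot u v).
  have -> : 2 * (a * b) * (a * b - dot u v) = dot (b *: u - a *: v) (b *: u - a *: v).

    transitivity (b ^+ 2 * dot u u + a ^+ 2 * dot v v - 2 * (a * b) * dot u v).
      by rewrite -!norm2_sqr -/a -/b; ring.
    rewrite /dot !mulr_sumr -big_split -!sumrB; apply: eq_bigr => i _ /=.
    by rewrite !mxE; ring.
  exact: dot_ge0.
have [ab0|ab0] := eqVneq (a * b) 0; last first.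
  have p : 0 < 2 * (a * b) by rewrite mulr_gt0// lt_def ab0 mulr_ge0.
  by rewrite -subr_ge0 -(pmulr_rge0 _ p).
rewrite ab0.
have dot0 (z y : 'cV[R]_n) : norm2 z = 0 -> dot z y = 0.
  move=> z0; have : dot z z = 0 by rewrite -norm2_sqr z0 expr0n.
  move=> /eqP; rewrite psumr_eq0; last by move=> j _; rewrite -expr2 sqr_ge0.
  move/allP => zz; rewrite /dot big1// => i _.
  by have := zz i (mem_index_enum _); rewrite -expr2 sqrf_eq0 => /eqP ->; rewrite mul0r.
move/eqP: ab0; rewrite mulf_eq0 => /orP[]/eqP z0; first by rewrite dot0.
have -> : dot u v = dot v u by apply: eq_bigr => i _; rewrite mulrC.
by rewrite dot0.
Qed.

Lemma is_derive_line n (f : 'cV[R]_n -> R) (x s : 'cV[R]_n) (t : R) :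
  differentiable f (x + t *: s) ->
  is_derive t 1 (fun t => f (x + t *: s)) (dot (grad f (x + t *: s)) s).
Proof.
move=> df; set y := x + t *: s.
have E : (fun h : R => h^-1 *: (((fun t => f (x + t *: s)) \o shift t) (h *: 1) - f y))
    = (fun h => h^-1 *: ((f \o shift y) (h *: s) - f y)).
  apply/funext => h /=; congr (_ *: (f _ - _)).
  by rewrite /y /= scaler1 scalerDl; rewrite addrCA.
have dfs : derivable f y s by exact: diff_derivable.
have dE : 'D_s f y = dot (grad f y) s.
  rewrite deriveE// [in LHS](matrix_sum_delta s) linear_sum /dot.
  apply: eq_bigr => i _; rewrite big_ord1 linearZ /= mxE deriveE// mulrC.
  by [].
split; first by rewrite /derivable E.
by rewrite /derive E -dE.
Qed.

Lemma descent_lemma n (f : 'cV[R]_n -> R) (L : R) (x s : 'cV[R]_n) :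
  (forall y, differentiable f y) -> lipschitz_gradient f L ->
  f (x + s) <= f x + dot (grad f x) s + L / 2 * dot s s.
Proof.
move=> df [L0 Lip].
(* The claim is [g 1 <= g 0]; the Lipschitz bound makes the derivative nonpositive for [t >= 0]. *)
pose g t : R := f (x + t *: s) - t * dot (grad f x) s - t ^+ 2 * (L / 2 * dot s s).
pose dg t : R := dot (grad f (x + t *: s)) s - dot (grad f x) s - t * (L * dot s s).
have dgP (t : R) : is_derive t 1 g (dg t).
  have h1 := is_derive_line (df (x + t *: s)).
  by rewrite /g /dg; apply: is_derive_eq; rewrite /GRing.scale /=; field.
have [|t tI] := @MVT_segment R g dg 0 1 ler01 (fun y _ => dgP y).
  by apply: derivable_within_continuous => y _; apply: ex_derive; exact: dgP.
rewrite /g scale1r scale0r addr0 => E.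
have t0 : 0 <= t by move: tI; rewrite in_itv/= => /andP[].
have : dg t <= 0.
  rewrite /dg -dotBl subr_le0; apply: le_trans (cauchy_schwarz _ _) _.
  apply: (@le_trans _ _ (L * norm2 (x + t *: s - x) * norm2 s)).
    by rewrite ler_wpM2r ?norm2_ge0.
  rewrite addrAC subrr add0r norm2Z ger0_norm// -norm2_sqr.
  by rewrite le_eqVlt; apply/orP; left; apply/eqP; ring.
lra.
Qed.

Lemma opnorm2_ge0 n (B : 'M[R]_n) : 0 <= opnorm2 B.
Proof.
rewrite /opnorm2; set A := (X in sup X).
have A0 : A (norm2 (B *m 0)).
  exists 0 => //=; rewrite /norm2 /dot big1 ?sqrtr0// => i _.
  by rewrite mxE mul0r.
have [ubA|nubA] := pselect (has_ubound A).
  apply: le_trans (ub_le_sup ubA A0); exact: norm2_ge0.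
(* The supremum of an unbounded set is 0 by convention, so no bound on the image of the ball has to
   be proved. *)
by rewrite sup_out// => -[].
Qed.

End Descent.

Section OneIteration.
Context {R : realType} (l d : nat).
Variables (f : 'cV[R]_d -> R) (theta C7 Bmax alpha : R) (x : 'cV[R]_d).
Variables (S : 'M[R]_(l, d)) (B : 'M[R]_d) (s : 'cV[R]_l).
Hypothesis C70 : 0 < C7.
Hypothesis theta01 : 0 < theta < 1.
Hypothesis hB : opnorm2 B <= Bmax.
Hypothesis hs : norm2 s <= alpha.
Let g := norm2 (S *m grad f x).
Hypothesis hm : ((C7 * g)%:E * mine alpha%:E (quot_oo g (opnorm2 B))
     <= (model_decrease f x S B s)%:E)%E.

(** A real [m] below both terms replaces the extended minimum; the product form of the second
    condition also covers a vanishing [opnorm2 B]. *)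
Lemma model_decrease_lower (m : R) : 0 <= m <= alpha -> m * Bmax <= g ->
  C7 * g * m <= model_decrease f x S B s.
Proof.
move=> /andP[m0 ma] mB; rewrite -lee_fin; apply: le_trans hm; rewrite EFinM.
apply: lee_wpmul2l; first by rewrite lee_fin mulr_ge0 ?norm2_ge0// ltW.
rewrite le_min lee_fin ma /= /quot_oo; case: eqP => [_|/eqP b0]; first exact: leey.
have bp : 0 < opnorm2 B by rewrite lt_def b0 opnorm2_ge0.
by rewrite lee_fin ler_pdivlMr//; apply: le_trans mB; rewrite ler_wpM2l.
Qed.

Lemma model_decrease_ge0 : 0 <= model_decrease f x S B s.
Proof.
have := @model_decrease_lower 0; rewrite lexx mulr0 mul0r; apply.
  by apply: le_trans hs; exact: norm2_ge0.
exact: norm2_ge0.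
Qed.

Lemma sufficient_decrease_gain (a m : R) : sufficient_decrease f theta x S B s ->
  0 < a <= g -> 0 <= m <= alpha -> m * Bmax <= a ->
  theta * (C7 * a * m) <= f x - f (x + S^T *m s).
Proof.
rewrite /sufficient_decrease => suff /andP[a0 ag] mI mB; apply: le_trans suff.
have /andP[t0 _] := theta01; have /andP[m0 _] := mI.
rewrite ler_wpM2l ?(ltW t0)//; apply: le_trans (model_decrease_lower mI _).
  by rewrite ler_wpM2r// ler_wpM2l// ltW.
exact: le_trans mB ag.
Qed.

Lemma small_radius_successful (L Smax a : R) :
  (forall y, differentiable f y) -> lipschitz_gradient f L ->
  possemidef B -> 0 < a <= g ->
  dot (S^T *m s) (S^T *m s) <= 2 * Smax ^+ 2 * dot s s ->
  L * Smax ^+ 2 * alpha <= a * (C7 * (1 - theta)) -> alpha * Bmax <= a ->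
  sufficient_decrease f theta x S B s.
Proof.
move=> df hL psd /andP[a0 ag] opS hsmall hBa.
have alpha0 : 0 <= alpha by apply: le_trans hs; exact: norm2_ge0.
have L0 : 0 <= L by case: hL.
have D : C7 * g * alpha <= model_decrease f x S B s.
  apply: model_decrease_lower; first by rewrite alpha0 lexx.
  exact: le_trans hBa ag.
have desc := descent_lemma x (S^T *m s) df hL.
have psd' := psd (S^T *m s).
have mE : model_decrease f x S B s =
    - dot (grad f x) (S^T *m s) - 2^-1 * dot (S^T *m s) (B *m (S^T *m s)).
  rewrite /model_decrease /model.
  have -> : dot (S *m grad f x) 0 = 0.
    by rewrite /dot big1// => i _; rewrite [X in _ * X]mxE mulr0.
  have -> (v : 'cV[R]_l) : dot 0 v = 0.
    by rewrite /dot big1// => i _; rewrite mxE mul0r.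
  have -> : dot s (S *m B *m S^T *m s) = dot (S^T *m s) (B *m (S^T *m s)).
    by rewrite dot_trmx !mulmxA.
  have -> : dot (S *m grad f x) s = dot (grad f x) (S^T *m s).
    by rewrite -[in LHS](trmxK S) dot_trmx.
  ring.
have ss : dot s s <= alpha * alpha.
  by rewrite -norm2_sqr expr2 ler_pM ?norm2_ge0.
have quad : L / 2 * dot (S^T *m s) (S^T *m s) <= a * (C7 * (1 - theta)) * alpha.
  apply: (@le_trans _ _ (L / 2 * (2 * Smax ^+ 2 * (alpha * alpha)))).
    rewrite ler_wpM2l ?divr_ge0//; apply: le_trans opS _.
    by rewrite ler_wpM2l// mulr_ge0// sqr_ge0.
  have -> : L / 2 * (2 * Smax ^+ 2 * (alpha * alpha)) = L * Smax ^+ 2 * alpha * alpha.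
    by field.
  by rewrite ler_wpM2r.
have /andP[_ t1] := theta01.
have quad' : a * (C7 * (1 - theta)) * alpha <= (1 - theta) * (C7 * g * alpha).
  have -> : a * (C7 * (1 - theta)) * alpha = (1 - theta) * (C7 * a * alpha) by ring.
  by rewrite ler_wpM2l ?subr_ge0 ?(ltW t1)// ler_wpM2r// ler_wpM2l// ltW.
have D' : (1 - theta) * (C7 * g * alpha) <= (1 - theta) * model_decrease f x S B s.
  by rewrite ler_wpM2l ?subr_ge0 ?(ltW t1).
(* With [step = S^T *m s], the descent lemma and [mE] give an actual decrease of at least the model
   decrease plus [dot step (B *m step) / 2] minus [L / 2 * dot step step]. The curvature term is
   nonnegative, and the last one is at most [1 - theta] times the model decrease. *)
rewrite /sufficient_decrease; lra.
Qed.

End OneIteration.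

(** * Counting the iterations of one run *)

(* [n k] is the number of factors [gamma1] separating the radius from its cap,
   and [T] the level from which true iterations succeed. The potentials
   [minn (n k) T] and [n k - T] are the ones behind the two inequalities. *)
Lemma true_iterations_count (n : nat -> nat) (succ tr : nat -> bool)
    (p tau c N : nat) : (0 < c)%N -> n 0%N = p ->
  (forall k, n k.+1 = if succ k then n k - c else (n k).+1)%N ->
  (forall k, (k < N)%N -> tr k -> (p + tau <= n k)%N -> succ k) ->
  (c.+1 * \sum_(k < N) tr k <=
   c.+1 * (\sum_(k < N) [&& tr k, succ k & n k < p + tau + c]) + c * N + tau)%N.
Proof.
move=> c0 n0 nS small; set T := (p + tau)%N.
pose u1 m := (\sum_(k < m) (~~ succ k && (n k < T)))%N.
pose u2 m := (\sum_(k < m) (~~ succ k && (T <= n k)))%N.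
pose s1 m := (\sum_(k < m) (succ k && (n k < T + c)))%N.
pose s2 m := (\sum_(k < m) (succ k && (T + c <= n k)))%N.
pose g m := (\sum_(k < m) [&& tr k, succ k & n k < T + c])%N.
(* A miss below [T] raises [minn (n k) T] by one, and a success lowers it by at most [c], or not at
   all when [n k >= T + c]. A miss from [T] upwards raises [n k - T] by one, and a success from
   [T + c] upwards lowers it by [c]. No miss from [T] upwards is true, whence the fourth clause. *)
have inv m : (m <= N)%N ->
   [/\ (u1 m + p <= minn (n m) T + c * s1 m)%N,
       (c * s2 m + (n m - T) <= u2 m)%N,
       (u1 m + u2 m + s1 m + s2 m = m)%N &
       (\sum_(k < m) tr k <= g m + s2 m + u1 m)%N].
  elim: m => [|m IH] mN.
    by rewrite /u1 /u2 /s1 /s2 /g !big_ord0 n0 /T; split; lia.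
  have [I1 I2 I3 I4] := IH (ltnW mN).
  rewrite /u1 /u2 /s1 /s2 /g !big_ord_recr /=.
  rewrite -/(u1 m) -/(u2 m) -/(s1 m) -/(s2 m) -/(g m) nS.
  have := small m mN; rewrite -/T.
  move: I1 I2 I3 I4.
  move: (u1 m) (u2 m) (s1 m) (s2 m) (g m) (\sum_(k < m) tr k)%N
    => a1 a2 b1 b2 G W I1 I2 I3 I4.
  rewrite !(mulnDr c) ?muln0 ?muln1.
  case: (succ m) => /= H; last first.
    have [nT|nT] := ltnP (n m) T => /=.
      by case: (tr m); split; lia.
    have -> : tr m = false by apply/negP => /H /(_ nT).
    by split; lia.
  by have [nT|nT] := ltnP (n m) (T + c) => /=; case: (tr m); split; lia.
have [I1 I2 I3 I4] := inv N (leqnn N).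
rewrite -/(g N); move: I1 I2 I3 I4.
move: (u1 N) (u2 N) (s1 N) (s2 N) (g N) (\sum_(k < N) tr k)%N => a1 a2 b1 b2 G W.
(* The clauses give [a1 <= tau + c * b1] and [c * b2 <= a2], hence [b2 <= c * a2] as [c >= 1];
   adding these bounds [c.+1 * (a1 + b2)] by [c * N + tau]. *)
rewrite /T; nia.
Qed.

Section Run.
Context {R : realType} (l d : nat).
Variables (f : 'cV[R]_d -> R) (L fstar : R).
Variables (gamma1 gamma2 theta alphamax alpha0 C7 Bmax Smax a gain : R).
Variables (x0 : 'cV[R]_d) (p tau c N : nat) (tr : nat -> bool).
Variables (S : nat -> 'M[R]_(l, d)) (B : nat -> 'M[R]_d) (s : nat -> 'cV[R]_l).
Variables (x_ : nat -> 'cV[R]_d) (alpha : nat -> R).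
Hypothesis df : forall y, differentiable f y.
Hypothesis hL : lipschitz_gradient f L.
Hypothesis hfstar : forall y, fstar <= f y.
Hypothesis c0 : (0 < c)%N.
Hypothesis gamma01 : 0 < gamma1 < 1.
Hypothesis gamma2E : gamma2 = gamma1 ^- c.
Hypothesis theta01 : 0 < theta < 1.
Hypothesis alphamax0 : 0 < alphamax.
Hypothesis alpha0E : alpha0 = alphamax * gamma1 ^+ p.
Hypothesis C70 : 0 < C7.
Hypothesis run : trust_region_run f gamma1 gamma2 theta alphamax C7 x0 alpha0
  S B s x_ alpha.
Hypothesis hB : forall k, opnorm2 (B k) <= Bmax.
Hypothesis a0 : 0 < a.
Hypothesis small1 : L * Smax ^+ 2 * (alpha0 * gamma1 ^+ tau) <= a * (C7 * (1 - theta)).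
Hypothesis small2 : alpha0 * gamma1 ^+ tau * Bmax <= a.
Hypothesis gain0 : 0 < gain.
Hypothesis gain_le : gain <= alpha0 * gamma1 ^+ (tau + c).
Hypothesis trueP : forall k, (k < N)%N -> tr k ->
  a <= norm2 (S k *m grad f (x_ k)) /\
  forall v, dot ((S k)^T *m v) ((S k)^T *m v) <= 2 * Smax ^+ 2 * dot v v.

Let succ k := sufficient_decrease f theta (x_ k) (S k) (B k) (s k).

(** Truncated subtraction encodes the cap: level 0 is the radius [alphamax]. *)
Fixpoint radius_level k : nat :=
  if k is k'.+1
  then (if succ k' then radius_level k' - c else (radius_level k').+1)%N
  else p.

Lemma radius_levelE k : alpha k = alphamax * gamma1 ^+ radius_level k.
Proof.
have /andP[g0 g1] := gamma01.
elim: k => [|k IH]; first by rewrite (run_alpha0 run) alpha0E.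
rewrite (run_alpha run) -/(succ k) /=; case: ifP => _; last first.
  by rewrite IH exprS mulrCA.
rewrite IH gamma2E; move: (radius_level k) => n.
have gc : 0 < gamma1 ^+ c by rewrite exprn_gt0.
have [cn|nc] := leqP c n.
  have -> : gamma1 ^- c * (alphamax * gamma1 ^+ n) =
      alphamax * gamma1 ^+ (n - c).
    by rewrite mulrCA -[in LHS](subnKC cn) exprD mulKf// gt_eqF.
  by rewrite min_r// ler_piMr ?(ltW alphamax0)// exprn_ile1 ?(ltW g0) ?(ltW g1).
have -> : (n - c)%N = 0%N by apply/eqP; rewrite subn_eq0 ltnW.
rewrite expr0 mulr1 min_l// mulrCA ler_peMr ?(ltW alphamax0)//.
by rewrite mulrC ler_pdivlMr// mul1r ler_wiXn2l ?(ltW g0) ?(ltW g1)// ltnW.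
Qed.

Lemma true_small_level_successful k : (k < N)%N -> tr k ->
  (p + tau <= radius_level k)%N -> succ k.
Proof.
have /andP[g0 g1] := gamma01.
move=> kN /(trueP kN)[ag op] lev.
have L0 : 0 <= L by case: hL.
have Bmax0 : 0 <= Bmax by apply: le_trans (hB k); exact: opnorm2_ge0.
have al : alpha k <= alpha0 * gamma1 ^+ tau.
  rewrite radius_levelE alpha0E -mulrA -exprD ler_pM2l//.
  by rewrite ler_wiXn2l ?(ltW g0) ?(ltW g1).
apply: (small_radius_successful C70 theta01 (hB k) (run_radius run k)
  (run_model_decrease run k) df hL (run_possemidef run k) (a := a) (Smax := Smax)).
- by rewrite a0.
- exact: op.
- by apply: le_trans small1; rewrite ler_wpM2l// mulr_ge0// sqr_ge0.
- by apply: le_trans small2; rewrite ler_wpM2r.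
Qed.

Lemma objective_decrease m : (m <= N)%N ->
  theta * (C7 * a * gain) * (\sum_(k < m)
    [&& tr k, succ k & radius_level k < p + tau + c])%N%:R <= f x0 - f (x_ m).
Proof.
have /andP[g0 g1] := gamma01; have /andP[t0 t1] := theta01.
elim: m => [|m IH] mN; first by rewrite big_ord0 mulr0 (run_x0 run) subrr.
rewrite big_ord_recr /= natrD mulrDr.
apply: (@le_trans _ _ ((f x0 - f (x_ m)) + (f (x_ m) - f (x_ m.+1)))); last first.
  by rewrite addrA subrK.
rewrite lerD ?IH// ?(ltnW mN)// (run_x run) -/(succ m).
have [sm|sm] := boolP (succ m); last by rewrite andbF subrr mulr0.
rewrite /=; have [/andP[trm lev]|_] := boolP (tr m && _); last first.
  (* A successful iteration that is not counted still does not increase [f]. *)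
  rewrite mulr0; apply: (@le_trans _ _ (theta * model_decrease f (x_ m) (S m) (B m) (s m))).
    rewrite mulr_ge0 ?(ltW t0)//.
    exact: (model_decrease_ge0 C70 (hB m) (run_radius run m) (run_model_decrease run m)).
  exact: sm.
rewrite mulr1; have [ag op] := trueP mN trm.
have Bmax0 : 0 <= Bmax by apply: le_trans (hB m); exact: opnorm2_ge0.
have al : gain <= alpha m.
  apply: le_trans gain_le _; rewrite radius_levelE alpha0E -mulrA -exprD ler_pM2l//.
  by rewrite ler_wiXn2l ?(ltW g0) ?(ltW g1)// addnA ltnW.
apply: (sufficient_decrease_gain C70 theta01 (hB m) (run_model_decrease run m) sm).
- by rewrite a0.
- by rewrite (ltW gain0).
- apply: le_trans small2; rewrite ler_wpM2r//; apply: le_trans gain_le _.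
  rewrite alpha0E -!mulrA ler_pM2l// ler_wpM2l ?exprn_ge0 ?(ltW g0)//.
  by rewrite ler_wiXn2l ?(ltW g0) ?(ltW g1)// leq_addr.
Qed.

Lemma true_iterations_bound :
  (\sum_(k < N) tr k)%N%:R <=
  (f x0 - fstar) / (theta * (C7 * a * gain)) + (c * N + tau)%N%:R / c.+1%:R.
Proof.
have /andP[t0 t1] := theta01.
have h0 : 0 < theta * (C7 * a * gain) by rewrite !mulr_gt0.
have := true_iterations_count c0 (erefl : radius_level 0 = p)
  (fun k => erefl) true_small_level_successful.
set G := (\sum_(k < N) [&& _, _ & _])%N; rewrite -addnA => H.
have GN : G%:R <= (f x0 - fstar) / (theta * (C7 * a * gain)).
  rewrite ler_pdivlMr// mulrC; apply: le_trans (objective_decrease (leqnn N)) _.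
  by rewrite lerD2l lerN2.
apply: (@le_trans _ _ (G%:R + (c * N + tau)%N%:R / c.+1%:R)); last by rewrite lerD2r.
rewrite -(ler_pM2l (_ : 0 < c.+1%:R)) ?ltr0n// mulrDr [X in _ + X]mulrCA.
by rewrite mulfV ?pnatr_eq0// mulr1 -!natrM -natrD ler_nat.
Qed.

End Run.

(** * Measurability of the iterates *)

(** Measurability of [X] is entrywise, so [F] is not composed with it directly. Rounding the entries
    down to the grid of mesh [1 / (k+1)] gives maps with countably many values, whose composition
    with any [F] is measurable; continuity is used only for the limit. *)
Lemma measurable_continuous_mx {dT} {T : measurableType dT} {R : realType} n
    (F : 'cV[R]_n -> R) (X : T -> 'cV[R]_n) :
  continuous F -> measurable_mx X -> measurable_fun setT (fun w => F (X w)).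
Proof.
move=> cF mX.
pose z (k : nat) w : {ffun 'I_n -> int} := [ffun i => Num.floor (k.+1%:R * X w i 0)].
pose r (k : nat) (v : {ffun 'I_n -> int}) : 'cV[R]_n :=
  \col_i ((v i)%:~R / k.+1%:R).
have mz k v : measurable [set w | z k w = v].
  rewrite (_ : [set w | _] = \bigcap_(i in [set: 'I_n])
      [set w | Num.floor (k.+1%:R * X w i 0) = v i]); last first.
    apply/seteqP; split => [w /= <- i _ /=|w H]; first by rewrite ffunE.
    by apply/ffunP => i; rewrite ffunE; exact: H.
  apply: fin_bigcap_measurable => // i _.
  rewrite (_ : [set w | _] = [set w | ((v i)%:~R <= k.+1%:R * X w i 0) &&
      (k.+1%:R * X w i 0 < (v i + 1)%:~R)]).
    apply: measurable_bool_set; apply: measurable_and.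
      by apply: measurable_fun_ler => //; exact: measurable_funM.
    by apply: measurable_fun_ltr => //; exact: measurable_funM.
  apply/seteqP; split => w /=.
    by move=> <-; rewrite floor_le floorD1_gt.
  by move=> /andP[h1 h2]; apply: floor_def; rewrite h1.
apply: (@measurable_fun_cvg _ _ _ _ (fun k w => F (r k (z k w)))) => //.
- move=> k _ A mA; rewrite setTI.
  rewrite (_ : _ @^-1` A = \bigcup_(v in [set v | A (F (r k v))]) [set w | z k w = v]).
    rewrite bigcup_mkcond; apply: countable_bigcupT_measurable.
      exact: countableP.
    by move=> v; case: ifP.
  apply/seteqP; split => w /=; first by move=> AF; exists (z k w).
  by move=> [v Av /= ->].
- move=> w _; apply: (cvg_comp (fun k => r k (z k w)) F); last exact: cF.
  apply/cvg_ballP => e e0; near=> k.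
  split => // i j; rewrite ord1 mxE ffunE /ball/=.
  have k0 : (0 : R) < k.+1%:R by rewrite ltr0n.
  have : k.+1%:R^-1 < e by near: k; exact: (near_infty_natSinv_lt (PosNum e0)).
  move=> ke; apply: le_lt_trans ke.
  have fl := floor_le (k.+1%:R * X w i 0).
  have fg := floorD1_gt (k.+1%:R * X w i 0).
  rewrite intrD in fg.
  have -> : X w i 0 - (Num.floor (k.+1%:R * X w i 0))%:~R / k.+1%:R =
      (k.+1%:R * X w i 0 - (Num.floor (k.+1%:R * X w i 0))%:~R) / k.+1%:R.
    by rewrite mulrBl mulrAC mulfV ?gt_eqF// mul1r.
  rewrite normrM ger0_norm ?subr_ge0// ger0_norm ?invr_ge0 ?(ltW k0)//.
  by rewrite ler_piMl ?invr_ge0 ?(ltW k0)//; lra.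
Unshelve. all: by end_near. Qed.

Section MeasurableIterates.
Context {dO : measure_display} {Omega : measurableType dO} {R : realType}.
Variable P : probability Omega R.
Variables (l d : nat) (f : 'cV[R]_d -> R).
Variables (gamma1 gamma2 theta alphamax C7 alpha0 : R) (x0 : 'cV[R]_d).
Variables (S : nat -> Omega -> 'M[R]_(l, d)) (B : nat -> Omega -> 'M[R]_d).
Variables (s : nat -> Omega -> 'cV[R]_l) (x_ : nat -> Omega -> 'cV[R]_d).
Variable alpha : nat -> Omega -> R.
Hypothesis hf : continuously_differentiable f.
Hypothesis hrun : gaussian_trust_region P f gamma1 gamma2 theta alphamax C7
  x0 alpha0 S B s x_ alpha.

Definition history_events k : set (set Omega) :=
  \bigcup_(j in [set j | (j < k)%N])
     (mx_events (S j) `|` mx_events (B j) `|` mx_events (s j)).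

Lemma history_events_measurable k : history_events k `<=` measurable.
Proof.
move=> A [j _ [[|]|]] [ij _ [C mC <-]].
- by have [mS _ _] := gtr_gaussian hrun j; exact: mS.
- exact: (gtr_measurable_B hrun j).
- exact: (gtr_measurable_s hrun j).
Qed.

Lemma history_eventsS k : history_events k `<=` history_events k.+1.
Proof. by move=> A [j jk Aj]; exists j => //=; exact: ltnW. Qed.

Lemma history_sigmaS k : <<s history_events k >> `<=` <<s history_events k.+1 >>.
Proof.
by apply: sub_smallest2r; [exact: smallest_sigma_algebra|exact: history_eventsS].
Qed.

Let H k : measurableType _ := g_sigma_algebraType (history_events k).

Lemma measurable_history m n (M : Omega -> 'M[R]_(m, n)) k :
  mx_events M `<=` history_events k -> measurable_mx (M : H k -> 'M[R]_(m, n)).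
Proof.
move=> sub i j _ C mC; apply: sub_sigma_algebra; apply: sub.
by exists (i, j) => //; exists C.
Qed.

Lemma measurable_S_history k : measurable_mx (S k : H k.+1 -> 'M[R]_(l, d)).
Proof. by apply: measurable_history => A ?; exists k => //=; left; left. Qed.

Lemma measurable_B_history k : measurable_mx (B k : H k.+1 -> 'M[R]_d).
Proof. by apply: measurable_history => A ?; exists k => //=; left; right. Qed.

Lemma measurable_s_history k : measurable_mx (s k : H k.+1 -> 'cV[R]_l).
Proof. by apply: measurable_history => A ?; exists k => //=; right. Qed.

Lemma measurable_mx_historyS m n (M : Omega -> 'M[R]_(m, n)) k :
  measurable_mx (M : H k -> 'M[R]_(m, n)) ->
  measurable_mx (M : H k.+1 -> 'M[R]_(m, n)).
Proof. by move=> mM i j mT A mA; apply: history_sigmaS; exact: mM. Qed.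

Lemma measurable_grad {dT} {T : measurableType dT} (X : T -> 'cV[R]_d) :
  measurable_mx X -> measurable_mx (fun w => grad f (X w)).
Proof.
have [_ cg] := hf; move=> mX i j; rewrite ord1.
apply: (measurable_continuous_mx (F := fun x => grad f x i 0)) => // x.
apply: (cvg_comp (grad f) (fun M : 'cV[R]_d => M i 0) (cg x)).
exact: coord_continuous.
Qed.

Lemma measurable_objective {dT} {T : measurableType dT} (X : T -> 'cV[R]_d) :
  measurable_mx X -> measurable_fun setT (fun w => f (X w)).
Proof.
have [df _] := hf; move=> mX; apply: measurable_continuous_mx => // x.
exact: differentiable_continuous.
Qed.

Lemma measurable_trmx {dT} {T : measurableType dT} m n (M : T -> 'M[R]_(m, n)) :
  measurable_mx M -> measurable_mx (fun w => (M w)^T).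
Proof. by move=> mM i j; under eq_fun do rewrite mxE; exact: mM. Qed.

Lemma measurable_addmx {dT} {T : measurableType dT} m n (M M' : T -> 'M[R]_(m, n)) :
  measurable_mx M -> measurable_mx M' -> measurable_mx (fun w => M w + M' w).
Proof.
move=> mM mM' i j; under eq_fun do rewrite mxE.
by apply: measurable_funD; [exact: mM|exact: mM'].
Qed.

Lemma measurable_sufficient_decrease {dT} {T : measurableType dT}
    (X : T -> 'cV[R]_d) (S' : T -> 'M[R]_(l, d)) (B' : T -> 'M[R]_d)
    (s' : T -> 'cV[R]_l) :
  measurable_mx X -> measurable_mx S' -> measurable_mx B' -> measurable_mx s' ->
  measurable_fun setT
    (fun w => sufficient_decrease f theta (X w) (S' w) (B' w) (s' w)).
Proof.
move=> mX mS mB ms.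
have mstep : measurable_mx (fun w => (S' w)^T *m s' w).
  by apply: measurable_mulmx => //; exact: measurable_trmx.
have mmodel (v : T -> 'cV[R]_l) : measurable_mx v ->
    measurable_fun setT (fun w => model f (X w) (S' w) (B' w) (v w)).
  move=> mv; rewrite /model; apply: measurable_funD.
    apply: measurable_funD; first exact: measurable_objective.
    apply: measurable_dot => //; apply: measurable_mulmx => //.
    exact: measurable_grad.
  apply: measurable_funM => //; apply: measurable_dot => //.
  apply: measurable_mulmx => //; apply: measurable_mulmx; last exact: measurable_trmx.
  exact: measurable_mulmx.
apply: measurable_fun_ler.
  apply: measurable_funM => //; apply: measurable_funB; last exact: mmodel.
  by apply: (mmodel (fun=> 0)); exact: measurable_mx_cst.
apply: measurable_funB; first exact: measurable_objective.
by apply: measurable_objective; exact: measurable_addmx.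
Qed.

(** This predictability is what allows the gradient direction to be frozen against [S k]. *)
Lemma measurable_iterate k : measurable_mx (x_ k : H k -> 'cV[R]_d).
Proof.
elim: k => [|k IH] i j.
  rewrite (_ : (fun w => x_ 0%N w i j) = cst (x0 i j))//.
  by apply/funext => w; rewrite (run_x0 (gtr_run hrun w)).
have mS := @measurable_S_history k; have mB := @measurable_B_history k.
have ms := @measurable_s_history k; have mx := measurable_mx_historyS IH.
rewrite (_ : (fun w => x_ k.+1 w i j) = fun w =>
    if sufficient_decrease f theta (x_ k w) (S k w) (B k w) (s k w)
    then (x_ k w + (S k w)^T *m s k w) i j else x_ k w i j); last first.
  by apply/funext => w; rewrite (run_x (gtr_run hrun w)); case: ifP.
apply: measurable_fun_ifT; first exact: measurable_sufficient_decrease.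
  apply: measurable_addmx => //; apply: measurable_mulmx => //.
  exact: measurable_trmx.
exact: mx.
Qed.

End MeasurableIterates.

(** * Constants of the theorem *)

Section Constants.
Context {R : realType}.

Lemma quot_oo_le (X u v : R) : 0 <= u -> 0 <= v ->
  (X%:E <= quot_oo u v)%E -> X * v <= u.
Proof.
move=> u0 v0; rewrite /quot_oo; case: eqP => [->|/eqP vn0].
  by rewrite mulr0.
by rewrite lee_fin ler_pdivlMr// lt_def vn0.
Qed.

Lemma quot_oo_gt0 (u v : R) : 0 < u -> 0 <= v -> (0 < quot_oo u v)%E.
Proof.
move=> u0 v0; rewrite /quot_oo; case: eqP => [_|/eqP vn0]; first exact: lt0y.
by rewrite lte_fin divr_gt0// lt_def vn0.
Qed.

(** Both terms of the minimum inside [tau] are [a / alpha0] times those inside [h], so the two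
    constants share one number [X], real even when [m] is [+oo]. *)
Lemma fine_mine_scale (m : \bar R) (a alpha0 gamma2 : R) :
  (0 < m)%E -> 0 < a -> 0 < alpha0 -> 0 < gamma2 ->
  let X := fine (mine m (alpha0 / (a * gamma2))%:E) in
  [/\ 0 < X, (X%:E <= m)%E, X <= alpha0 / (a * gamma2) &
    fine (mine (a%:E * m * (alpha0^-1)%:E) (1 / gamma2)%:E)%E = a * X / alpha0].
Proof.
move=> m0 a0 al0 g0 X.
have y0 : 0 < alpha0 / (a * gamma2) by rewrite divr_gt0// mulr_gt0.
have E : 1 / gamma2 = a * (alpha0 / (a * gamma2)) / alpha0.
  by field; rewrite !gt_eqF.
case: m m0 @X => [r| |] // m0 X; rewrite /X.
- rewrite -EFin_min /= ; split.
  + by rewrite lt_min y0 andbT -lte_fin.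
  + by rewrite lee_fin ge_min lexx.
  + by rewrite ge_min lexx orbT.
  + rewrite E -!EFinM -EFin_min /=.
    by rewrite -minr_pMl ?invr_ge0 ?(ltW al0)// -minr_pMr ?(ltW a0)//.
- rewrite min_r ?leey//=; split; rewrite ?leey//.
  rewrite mulry gtr0_sg// mul1e mulyr gtr0_sg ?invr_gt0// mul1e.
  by rewrite min_r ?leey//= E.
Qed.

(** Rounding the exponent up loses at most one factor [g], and [M <= 1] makes the exponent a natural
    number. *)
Lemma expn_ceil_ln (g M : R) (c : nat) : 0 < g < 1 -> 0 < M -> M <= g ^+ c ->
  exists2 t : nat, Num.ceil (ln M / ln g) = t%:Z & g * M <= g ^+ t <= M.
Proof.
move=> /andP[g0 g1] M0 Mc; set y := ln M / ln g.
have lg : ln g < 0 by rewrite ln_lt0// g0.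
have lM : ln M <= 0.
  by rewrite ln_le0// (le_trans Mc)// exprn_ile1// ltW.
have y0 : 0 <= y by rewrite /y mulrC nmulr_rge0 ?invr_lt0.
have yE : y * ln g = ln M by rewrite /y divfK// lt_eqF.
have cy : 0 <= Num.ceil y by rewrite ceil_ge0// (lt_le_trans _ y0).
exists `|Num.ceil y|%N; first by rewrite gez0_abs.
set t := `|Num.ceil y|%N.
have tE : (t%:R : R) = (Num.ceil y)%:~R by rewrite -[Num.ceil y]gez0_abs.
have expE : g ^+ t = expR (ln g * t%:R) by rewrite expRM_natr lnK.
apply/andP; split.
  rewrite expE -[g in g * M]lnK// -[M in _ * M]lnK// -expRD ler_expR -yE.
  have : t%:R < y + 1.
    by rewrite tE -ltrBlDr; have := ceilB1_lt y; rewrite intrB.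
  by move=> ty; nra.
rewrite expE -[leRHS]lnK// ler_expR -yE mulrC.
by rewrite ler_wnM2r ?(ltW lg)// tE ceil_ge.
Qed.

End Constants.

(** * Hitting index and normalised gradients *)

Lemma N_eps_leP (R : realType) (g : nat -> R) (eps : R) (N : nat) :
  (N_eps g eps <= N%:R%:E)%E <-> exists2 k, (k <= N)%N & g k <= eps.
Proof.
have minP M : \big[Num.min/g 0%N]_(k < M.+1) g k <= eps <->
    exists2 k, (k <= M)%N & g k <= eps.
  split=> [|[k kM gk]].
    apply: contraPP => H; apply/negP; rewrite -ltNge.
    have H' k : (k <= M)%N -> eps < g k.
      by move=> kM; rewrite ltNge; apply/negP => gk; apply: H; exists k.
    by apply: lt_bigmin => [|k _]; apply: H'; rewrite // -ltnS.
  by apply: le_trans gk; exact: (bigmin_le_cond _ (j := Ordinal (kM : k < M.+1)%N)).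
split=> [|[k kN gk]].
  apply: contraPP => H; apply/negP; rewrite -ltNge.
  (* The set consists of integers, so if none is at most [N] its infimum is at least [N.+1]. *)
  apply: (@lt_le_trans _ _ (N.+1%:R%:E)); first by rewrite lte_fin ltr_nat.
  apply: le_ereal_inf_tmp => _ [M /= /minP[k kM gk] <-].
  rewrite lee_fin ler_nat ltnNge; apply/negP => MN; apply: H; exists k => //.
  exact: leq_trans MN.
apply: ereal_inf_lbound; exists N => //=; apply/minP; by exists k.
Qed.

Section UnitDirection.
Context {R : realType} (d : nat) (i0 : 'I_d).

(* The fallback value on the zero vector is irrelevant; it only keeps the
   direction of unit length. *)
Definition unit_direction (g : 'cV[R]_d) : 'cV[R]_d :=
  if dot g g <= 0 then delta_mx i0 0 else (dot g g) `^ (- 2^-1) *: g.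

Lemma powR_half_sqr (x : R) : 0 < x -> (x `^ (- 2^-1)) ^+ 2 = x^-1.
Proof.
move=> x0; rewrite -powR_mulrn ?powR_ge0// -powRrM mulNr mulVf//.
by rewrite powR_inv1// ltW.
Qed.

Lemma dot_unit_direction g : dot (unit_direction g) (unit_direction g) = 1.
Proof.
rewrite /unit_direction; case: leP => [_|g0].
  rewrite /dot (bigD1 i0)//= mxE !eqxx mulr1 big1 ?addr0// => i /negbTE ii0.
  by rewrite mxE ii0 mul0r.
by rewrite dotZZ powR_half_sqr// mulVf// gt_eqF.
Qed.

Lemma sketch_lower_bound l (A : 'M[R]_(l, d)) (g : 'cV[R]_d) (e : R) :
  0 < dot g g ->
  e <= dot (A *m unit_direction g) (A *m unit_direction g) ->
  e * dot g g <= dot (A *m g) (A *m g).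
Proof.
move=> g0; rewrite /unit_direction ifN -?ltNge//.
rewrite -scalemxAr dotZZ powR_half_sqr//.
by rewrite mulrC ler_pdivlMr.
Qed.

Lemma measurable_unit_direction {dT} {T : measurableType dT} (g : T -> 'cV[R]_d) :
  measurable_mx g -> measurable_mx (fun w => unit_direction (g w)).
Proof.
move=> mg i j; have mdg := measurable_dot mg mg.
rewrite (_ : (fun _ => _) = fun w => if dot (g w) (g w) <= 0
    then delta_mx i0 0 i j else (dot (g w) (g w)) `^ (- 2^-1) * g w i j); last first.
  by apply/funext => w; rewrite /unit_direction; case: ifP => //; rewrite mxE.
apply: measurable_fun_ifT => //; first exact: measurable_fun_ler.
apply: measurable_funM => //.
exact: (measurableT_comp (measurable_powR _) mdg).
Qed.

End UnitDirection.

(** * Combining the iteration count with the Chernoff bound *)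

Theorem theorem4p4
  (R : realType) (dO : measure_display) (Omega : measurableType dO)
  (P : probability Omega R)
  (d l c p N : nat)
  (f : 'cV[R]_d -> R) (L fstar : R)
  (gamma1 gamma2 theta alphamax alpha0 C7 Bmax : R) (x0 : 'cV[R]_d)
  (S : nat -> Omega -> 'M[R]_(l, d)) (B : nat -> Omega -> 'M[R]_d)
  (s : nat -> Omega -> 'cV[R]_l) (x_ : nat -> Omega -> 'cV[R]_d)
  (alpha : nat -> Omega -> R)
  (delta2 epsS delta1 deltaS Smax eps h : R) (alphalow : \bar R) (tau : int)
  (hf : continuously_differentiable f)
  (hL : lipschitz_gradient f L)
  (hfstar : is_minimum f fstar)
  (hl : (0 < l)%N) (hld : (l <= d)%N)
  (hc : (0 < c)%N) (hp : (0 < p)%N)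
  (hgamma1 : 0 < gamma1 < 1)
  (hgamma2 : gamma2 = gamma1 ^- c)
  (htheta : 0 < theta < 1)
  (halphamax : 0 < alphamax)
  (halpha0 : alpha0 = alphamax * gamma1 ^+ p)
  (hC7 : 0 < C7)
  (hrun : gaussian_trust_region P f gamma1 gamma2 theta alphamax C7 x0 alpha0
            S B s x_ alpha)
  (hBmax : 0 <= Bmax)
  (hB : forall k w, opnorm2 (B k w) <= Bmax)
  (hdelta2 : 0 < delta2) (hepsS : 0 < epsS < 1) (hdelta1 : 0 < delta1)
  (hdeltaS_def : deltaS = expR (- (l%:R * epsS ^+ 2 / 4)) + delta2)
  (hdeltaS : deltaS < c%:R / c.+1%:R ^+ 2)
  (hpos : 0 < ((1 - deltaS) * (1 - delta1) - 1 + c%:R / c.+1%:R ^+ 2)^-1)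
  (heps : 0 < eps)
  (hSmax : Smax = 1 + Num.sqrt (d%:R / l%:R)
                    + Num.sqrt (2 / l%:R * ln (1 / delta2)))
  (halphalow : alphalow =
     ((Num.sqrt (1 - epsS) * eps)%:E *
      mine (quot_oo (C7 * (1 - theta)) ((L + 2^-1 * Bmax) * Smax ^+ 2))
           (quot_oo 1 Bmax))%E)
  (htau : tau =
     Num.ceil (ln (fine (mine (alphalow * (alpha0^-1)%:E)
                              (1 / gamma2)%:E)%E) / ln gamma1))
  (hh : h = theta * C7 * (1 - epsS) * eps ^+ 2 * gamma1 ^+ c.+1 *
     fine (mine (mine
       (quot_oo (C7 * (1 - theta)) ((L + 2^-1 * Bmax) * Smax ^+ 2))
       (quot_oo 1 Bmax))
       (alpha0 / (Num.sqrt (1 - epsS) * eps * gamma2))%:E)%E)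
  (hN : ((1 - deltaS) * (1 - delta1) - 1 + c%:R / c.+1%:R ^+ 2)^-1 *
          ((f x0 - fstar) / h + tau%:~R / (1 + c%:R)) <= N%:R) :
  ((1 - expR (- (delta1 ^+ 2 / 2 * (1 - deltaS) * N%:R)))%:E
     <= P [set w | (N_eps (fun k => norm2 (grad f (x_ k w))) eps
                      <= N%:R%:E)%E])%E.
Proof.
have [df _] := hf; have [[xm fxm] fmin] := hfstar.
have [L0 _] := hL; have /andP[g0 g1] := hgamma1; have /andP[t0 t1] := htheta.
have /andP[e0 e1] := hepsS.
have d0 : (0 < d)%N by exact: leq_trans hl hld.
have cR : (0 : R) < c.+1%:R by rewrite ltr0n.
(* This forces [deltaS < 1], hence [delta2 < 1], which the logarithm in [Smax] needs to be
   positive. *)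
have c4 : c%:R / c.+1%:R ^+ 2 < 1 :> R.
  rewrite ltr_pdivrMr ?exprn_gt0// mul1r -natrX ltr_nat.
  by rewrite expnS expn1 (@leq_trans c.+1)// leq_pmulr.
have dS1 : deltaS < 1 by exact: lt_trans c4.
have dS0 : 0 <= deltaS by rewrite hdeltaS_def addr_ge0 ?expR_ge0// ltW.
have delta21 : 0 < delta2 < 1.
  by rewrite hdelta2 (le_lt_trans _ dS1)// hdeltaS_def lerDr expR_ge0.
have al0 : 0 < alpha0 by rewrite halpha0 mulr_gt0// exprn_gt0.
have g20 : 0 < gamma2 by rewrite hgamma2 invr_gt0 exprn_gt0.
have Smax0 : 0 < Smax.
  by rewrite hSmax -addrA ltr_pwDl// addr_ge0// sqrtr_ge0.
have se0 : 0 < Num.sqrt (1 - epsS) by rewrite sqrtr_gt0 subr_gt0.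
(* On a true iteration [a] bounds the sketched gradient norm from below as long as the gradient norm
   exceeds [eps]. *)
set a := Num.sqrt (1 - epsS) * eps in halphalow hh.
have a0 : 0 < a by rewrite mulr_gt0.
have a2 : a ^+ 2 = (1 - epsS) * eps ^+ 2.
  by rewrite exprMn sqr_sqrtr// subr_ge0 ltW.
set u1 := C7 * (1 - theta) in halphalow hh.
set v1 := (L + 2^-1 * Bmax) * Smax ^+ 2 in halphalow hh.
have u10 : 0 < u1 by rewrite mulr_gt0// subr_gt0.
have LB0 : 0 <= L + 2^-1 * Bmax by rewrite addr_ge0// mulr_ge0.
have v10 : 0 <= v1 by rewrite mulr_ge0// sqr_ge0.
set m12 := mine (quot_oo u1 v1) (quot_oo 1 Bmax) in halphalow hh.
have m120 : (0 < m12)%E by rewrite lt_min !quot_oo_gt0.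
have [X0 Xm Xal ME] := fine_mine_scale m120 a0 al0 g20.
set X := fine _ in X0 Xm Xal ME hh.
have Xv1 : X * v1 <= u1.
  by apply: quot_oo_le => //; [exact: ltW|apply: le_trans Xm _; rewrite ge_min lexx].
have XB : X * Bmax <= 1.
  by apply: quot_oo_le => //; apply: le_trans Xm _; rewrite ge_min lexx orbT.
rewrite halphalow ME in htau.
have M0 : 0 < a * X / alpha0 by rewrite divr_gt0// mulr_gt0.
have Mc : a * X / alpha0 <= gamma1 ^+ c.
  rewrite ler_pdivrMr//; apply: le_trans (ler_wpM2l (ltW a0) Xal) _.
  rewrite le_eqVlt; apply/orP; left; apply/eqP; rewrite hgamma2.
  by rewrite invfM invrK; field; rewrite gt_eqF.
have [tn tauE /andP[tlo thi]] := expn_ceil_ln hgamma1 M0 Mc.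
rewrite tauE in htau; rewrite {}htau in hN.
have aX : alpha0 * gamma1 ^+ tn <= a * X.
  by rewrite mulrC -ler_pdivlMr.
(* A lower bound for the radius on counted iterations: [c] factors come from their level being below
   [p + tau + c], one more from the ceiling in [tau]. *)
pose gain := gamma1 ^+ c.+1 * (a * X).
have gain0 : 0 < gain by rewrite !mulr_gt0 ?exprn_gt0.
have gain_le : gain <= alpha0 * gamma1 ^+ (tn + c).
  have -> : gain = gamma1 ^+ c * (gamma1 * (a * X)) by rewrite /gain exprSr -mulrA.
  rewrite exprD [leRHS]mulrA [leRHS]mulrC ler_wpM2l ?exprn_ge0 ?(ltW g0)//.
  have := ler_wpM2l (ltW al0) tlo; apply: le_trans.
  by rewrite le_eqVlt; apply/orP; left; apply/eqP; field; rewrite gt_eqF.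
have hE : h = theta * (C7 * a * gain).
  rewrite hh /gain -[theta * C7 * (1 - epsS) * _]mulrA -a2.
  by ring.
have small1 : L * Smax ^+ 2 * (alpha0 * gamma1 ^+ tn) <= a * (C7 * (1 - theta)).
  apply: (@le_trans _ _ (v1 * (a * X))).
    apply: ler_pM => //; first by rewrite mulr_ge0// sqr_ge0.
      by rewrite mulr_ge0 ?exprn_ge0 ?(ltW al0) ?(ltW g0).
    by rewrite /v1 ler_wpM2r ?sqr_ge0// lerDl mulr_ge0.
  by rewrite mulrCA ler_wpM2l ?(ltW a0)// mulrC.
have small2 : alpha0 * gamma1 ^+ tn * Bmax <= a.
  apply: le_trans (ler_wpM2r hBmax aX) _.
  by rewrite -mulrA ler_piMr// ltW.
have [n [b [b' [lam hop]]]] := coin_mgf_opnorm hl d0 delta21 hSmax.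
pose u k w := unit_direction (Ordinal d0) (grad f (x_ k w)).
pose E k := [set w | (1 - epsS <= dot (S k w *m u k w) (S k w *m u k w))
  && (coin_mgf n b b' lam (S k w) < delta2^-1)].
have mgrad k : measurable_mx (fun w : g_sigma_algebraType (history_events S B s k) =>
    grad f (x_ k w)).
  by apply: (measurable_grad hf); exact: measurable_iterate hf hrun k.
have mu k : measurable_mx (u k : g_sigma_algebraType (history_events S B s k) -> _).
  exact: measurable_unit_direction.
have mG := history_events_measurable hrun.
have GE k : <<s history_events S B s k.+1 >> (E k).
  pose T : measurableType _ := g_sigma_algebraType (history_events S B s k.+1).
  have mS : measurable_mx (S k : T -> 'M[R]_(l, d)) by exact: measurable_S_history.
  apply: (@measurable_bool_set _ T); apply: measurable_and.
    apply: measurable_fun_ler => //; apply: measurable_dot;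
      by apply: measurable_mulmx => //; exact: measurable_mx_historyS.
  by apply: measurable_fun_ltr => //; exact: measurable_coin_mgf.
have Eq k A : <<s history_events S B s k >> A ->
    (P (A `&` ~` E k) <= deltaS%:E * P A)%E.
  move=> GA; rewrite hdeltaS_def.
  have ind : independent_systems P <<s history_events S B s k >> <<s mx_events (S k) >>.
    by have [_ _ _ + _] := hrun; apply.
  have H := @sketch_failure_given_past _ _ _ P l d (S k)
    (history_events S B s k) hl (gtr_gaussian hrun k) (mG k)
    ind n b b' lam delta2 (u k) epsS A hdelta2 (mu k)
    (fun w => dot_unit_direction _ _) (ltW e0) GA.
  exact: H.
have dS01 : 0 <= deltaS <= 1 by rewrite dS0 ltW.
have bad := adaptive_chernoff mG (@history_eventsS _ _ _ _ _ S B s) GE dS01 Eq N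
  (ltW hdelta1).
set Bad := [set w | _] in bad.
set Good := [set w | _].
have normE (v : 'cV[R]_d) : (norm2 v <= eps) = (dot v v <= eps ^+ 2).
  by rewrite -norm2_sqr ler_pXn2r ?nnegrE ?norm2_ge0// ltW.
have mGood : measurable Good.
  rewrite (_ : Good = \bigcup_(k in [set k | (k <= N)%N])
      [set w | dot (grad f (x_ k w)) (grad f (x_ k w)) <= eps ^+ 2]); last first.
    apply/seteqP; split => w; rewrite /Good /=.
      by move/N_eps_leP => [k kN]; rewrite normE; exists k.
    by move=> [k kN] /= gk; apply/N_eps_leP; exists k => //; rewrite normE.
  apply: bigcup_measurable => k _; apply: measurable_bool_set.
  apply: measurable_fun_ler => //.
  have mid := measurable_id_sigma (mG k).
  by apply: measurable_dot => i j; exact: (measurableT_comp (mgrad k i j) mid).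
have mBad : measurable Bad.
  exact: measurable_hits_le mG (@history_eventsS _ _ _ _ _ S B s) GE _ _.
(* On a path whose gradients exceed [eps] up to index [N], every hit is a true iteration, so the
   deterministic count bounds [hits]. *)
have sub : ~` Good `<=` Bad.
  move=> w; rewrite /Good /Bad /= => nG.
  have geps k : (k <= N)%N -> eps < norm2 (grad f (x_ k w)).
    move=> kN; rewrite ltNge; apply/negP => gk; apply: nG; apply/N_eps_leP.
    by exists k.
  have tP k : (k < N)%N -> w \in E k ->
      a <= norm2 (S k w *m grad f (x_ k w)) /\
      forall v, dot ((S k w)^T *m v) ((S k w)^T *m v) <= 2 * Smax ^+ 2 * dot v v.
    move=> kN /set_mem /= /andP[h1 h2]; split; last exact: hop.
    have gk := geps k (ltnW kN).
    have gg : eps ^+ 2 < dot (grad f (x_ k w)) (grad f (x_ k w)).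
      by rewrite ltNge -normE -ltNge.
    have gp : 0 < dot (grad f (x_ k w)) (grad f (x_ k w)).
      by apply: lt_trans gg; rewrite exprn_gt0.
    rewrite -(@ler_pXn2r _ 2) ?nnegrE ?norm2_ge0 ?(ltW a0)// norm2_sqr a2.
    apply: le_trans (sketch_lower_bound gp h1).
    by rewrite ler_wpM2l ?(ltW gg)// subr_ge0 ltW.
  have bnd := true_iterations_bound df hL fmin hc hgamma1 hgamma2 htheta halphamax
    halpha0 hC7 (gtr_run hrun w) (fun k => hB k w) a0 small1 small2 gain0 gain_le tP.
  rewrite -hE in bnd.
  rewrite leNgt; apply/negP => big.
  have K0 : 0 < (1 - deltaS) * (1 - delta1) - 1 + c%:R / c.+1%:R ^+ 2.
    by rewrite -invr_gt0.
  rewrite ler_pdivrMl// in hN.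
  set D := (f x0 - fstar) / h in bnd hN.
  (* In terms of [y] all fractions are polynomial, and the contradiction is the sign of the margin
     [y ^+ 2 * N%:R]. *)
  pose y : R := c.+1%:R^-1.
  have cE : c%:R = c.+1%:R - 1 :> R by rewrite -natr1 addrK.
  have cy : c%:R * y = 1 - y by rewrite cE mulrBl mulfV ?mul1r// gt_eqF.
  have c2 : c%:R / c.+1%:R ^+ 2 = y - y ^+ 2.
    by rewrite expr2 invfM mulrA -/y cy mulrBl mul1r -expr2.
  have tc : tn%:~R / (1 + c%:R) = tn%:R * y by rewrite nat1r.
  have bE : (c * N + tn)%N%:R / c.+1%:R = (1 - y) * N%:R + tn%:R * y.
    by rewrite natrD natrM mulrDl -/y mulrAC cy.
  rewrite tc c2 in hN; rewrite bE in bnd.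
  have yN : 0 <= y ^+ 2 * N%:R by rewrite mulr_ge0// sqr_ge0.
  have {}big := lt_le_trans big bnd.
  lra.
have PG : P Good = (1 - P (~` Good))%E.
  by rewrite -(setCK Good) probability_setC ?setCK//; exact: measurableC.
rewrite PG EFinB leeB//; apply: le_trans bad.
by apply: le_measure; rewrite ?inE//; exact: measurableC.
Qed.
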